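(* Let $\mathbf{m}\in\mathcal{M}$ and $\boldsymbol{\lambda}\in\Lambda$. If $\mathbf{n}=(n_{\mathcal{C},j})\in\mathcal{M}^G$, i.e. $n_{\mathcal{C},0}=n_{\mathcal{C},1}=\cdots=n_{\mathcal{C},e_{\mathcal{C}}-1}$ for all $\mathcal{C}\in\mathcal{A}/W$, then $$s^{\varphi_{\mathbf{m}}}_{\boldsymbol{\lambda}}=s^{\varphi_{\mathbf{m}+\mathbf{n}}}_{\boldsymbol{\lambda}}.$$ In particular, $a^{\varphi_{\mathbf{m}}}_{\boldsymbol{\lambda}}=a^{\varphi_{\mathbf{m}+\mathbf{n}}}_{\boldsymbol{\lambda}}$.
   Context: **Group and generic Hecke algebra.** Let $K$ be a finite abelian extension of $\mathbb{Q}$ with ring of integers $\mathbb{Z}_K$ and group of roots of unity $\mu(K)$; $\zeta_d:=\exp(2\pi i/d)$. Let $V$ be a finite dimensional $K$-vector space and $W\subset \mathrm{GL}(V)$ a finite group generated by pseudo-reflections and acting irreducibly on $V$. Let $\mathcal{A}$ be the set of reflecting hyperplanes, $V^{\mathrm{reg}}=V-\bigcup_{H\in\mathcal{A}}H$ (after extending scalars to $\mathbb{C}$), $x_0\in V^{\mathrm{reg}}$, $B=\Pi_1(V^{\mathrm{reg}}/W,x_0)$ the braid group. For an orbit $\mathcal{C}\in\mathcal{A}/W$, let $\mathbf{S}_{\mathcal{C}}$ be the set of monodromy generators around the images in $V^{\mathrm{reg}}/W$ of the elements of $\mathcal{C}$, and $e_{\mathcal{C}}$ the common order of the pointwise stabilizers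 $W_H$, $H\in\mathcal{C}$. Let $\mathbf{u}=(u_{\mathcal{C},j})_{\mathcal{C}\in\mathcal{A}/W,\,0\le j\le e_{\mathcal{C}}-1}$ be indeterminates. The generic Hecke algebra $\mathcal{H}(W)$ is the quotient of $\mathbb{Z}[\mathbf{u},\mathbf{u}^{-1}]B$ by the ideal generated by the elements $(\mathbf{s}-u_{\mathcal{C},0})\cdots(\mathbf{s}-u_{\mathcal{C},e_{\mathcal{C}}-1})$, for $\mathcal{C}\in\mathcal{A}/W$, $\mathbf{s}\in\mathbf{S}_{\mathcal{C}}$. **Standing assumptions.** $\mathcal{H}(W)$ is a free $\mathbb{Z}[\mathbf{u},\mathbf{u}^{-1}]$-module of rank $|W|$, and there is a unique symmetrizing form $t$ on $\mathcal{H}(W)$ (a linear form with $t(hh')=t(h'h)$ and $(h,h')\mapsto t(hh')$ non-degenerate) such that (i) under $u_{\mathcal{C},j}\mapsto\zeta_{e_{\mathcal{C}}}^j$ it becomes the canonical form $w\mapsto\delta_{w,1}$ of the group algebra of $W$; (ii) for all $b\in B$, $t(b^{-1})^{*}=t(b\pi)/t(\pi)$, where $*$ is the automorphism $u_{\mathcal{C},j}\mapsto u_{\mathcal{C},j}^{-1}$ and $\pi$ is the central element of $B$ given by the loop $s\mapsto \exp(2\pi i s)x_0$, $0\le s\le1$. Let $\mathbf{v}=(v_{\mathcal{C},j})$ be indeterminates with $v_{\mathcal{C},j}^{|\mu(K)|}=\zeta_{e_{\mathcal{C}}}^{-j}u_{\mathcal{C},j}$; then $K(\mathbf{v})\mathcal{H}(W)$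 is split semisimple (known). **Cyclotomic Hecke algebras.** Let $q$ be an indeterminate and $y^{|\mu(K)|}=q$. Let $\mathcal{M}=\prod_{\mathcal{C}\in\mathcal{A}/W}\mathbb{Z}^{e_{\mathcal{C}}}$, on which $G=\prod_{\mathcal{C}\in\mathcal{A}/W}\mathbb{Z}/e_{\mathcal{C}}\mathbb{Z}$ acts by cyclic permutation: $(\mathbf{g}.\mathbf{m})_{\mathcal{C},j}=m_{\mathcal{C},j+g_{\mathcal{C}}}$ (second subscripts modulo $e_{\mathcal{C}}$); $\mathcal{M}^G$ is the set of fixed points. For $\mathbf{m}=(m_{\mathcal{C},j})\in\mathcal{M}$, the cyclotomic specialization $\varphi_{\mathbf{m}}:\mathbb{Z}_K[\mathbf{v},\mathbf{v}^{-1}]\to\mathbb{Z}_K[y,y^{-1}]$ is the $\mathbb{Z}_K$-algebra morphism $v_{\mathcal{C},j}\mapsto y^{m_{\mathcal{C},j}}$, i.e. $u_{\mathcal{C},j}\mapsto\zeta_{e_{\mathcal{C}}}^jq^{m_{\mathcal{C},j}}$. The cyclotomic Hecke algebra $\mathcal{H}_{\mathbf{m}}$ is the $\mathbb{Z}_K[q,q^{-1}]$-algebra obtained by specializing $\mathcal{H}(W)$ via $\varphi_{\mathbf{m}}$, with symmetrizing form $t_{\varphi_{\mathbf{m}}}$ the specialization of $t$. The algebra $K(y)\mathcal{H}_{\mathbf{m}}$ is split semisimple (known). Fix an indexing set $\Lambda$ with $\mathrm{Irr}(W)=\{V^{\boldsymbol{\lambda}}\mid\boldsymbol{\lambda}\in\Lambda\}$;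 by Tits' deformation theorem the specialization $v_{\mathcal{C},j}\mapsto1$ (thus $y\mapsto 1$) induces bijections $\mathrm{Irr}(K(\mathbf{v})\mathcal{H}(W))\leftrightarrow\mathrm{Irr}(K(y)\mathcal{H}_{\mathbf{m}})\leftrightarrow\mathrm{Irr}(W)$, and one writes $\mathrm{Irr}(K(y)\mathcal{H}_{\mathbf{m}})=\{V^{\boldsymbol{\lambda}}_{\varphi_{\mathbf{m}}}\mid\boldsymbol{\lambda}\in\Lambda\}$. **Schur elements and $a$-function.** The Schur elements $s^{\varphi_{\mathbf{m}}}_{\boldsymbol{\lambda}}\in\mathbb{Z}_K[y,y^{-1}]$ are defined by $t_{\varphi_{\mathbf{m}}}=\sum_{\boldsymbol{\lambda}\in\Lambda}\frac{1}{s^{\varphi_{\mathbf{m}}}_{\boldsymbol{\lambda}}}\chi_{\boldsymbol{\lambda}}$, $\chi_{\boldsymbol{\lambda}}$ the character of $V^{\boldsymbol{\lambda}}_{\varphi_{\mathbf{m}}}$. For a Laurent polynomial $P(y)$, $\mathrm{val}_y(P)$ is its order at $0$, and $\mathrm{val}_q(P)=\mathrm{val}_y(P)/|\mu(K)|$. Set $a^{\varphi_{\mathbf{m}}}_{\boldsymbol{\lambda}}:=-\mathrm{val}_q(s^{\varphi_{\mathbf{m}}}_{\boldsymbol{\lambda}})$. *)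

(* Defs.v *)
From HB Require Import structures.
From mathcomp Require Import all_boot all_order all_algebra all_fingroup.
From mathcomp Require Import all_field all_character.
From mathcomp Require Import generic_quotient complex finmap.
From mathcomp Require Import all_classical all_reals all_analysis.
From mathcomp Require Import ring lra.

Set Implicit Arguments.
Unset Strict Implicit.
Unset Printing Implicit Defensive.

Import Order.TTheory GRing.Theory Num.Theory.
Import numFieldNormedType.Exports.

Local Open Scope ring_scope.

Section Paths.
Context {R : realType} {T : topologicalType}.
Local Open Scope classical_set_scope.
Implicit Types (x y z : T) (f g h : R -> T).

(* Paths are functions on R of which only the values on [0, 1] matter.         *)
Definition is_path x y f :=
  [/\ {within `[0, 1], continuous f}, f 0 = x & f 1 = y].

Definition homotopic x y f g := exists H : R * R -> T,
  [/\ {within `[0, 1] `*` `[0, 1], continuous H},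
      forall t, 0 <= t <= 1 -> H (0, t) = f t,
      forall t, 0 <= t <= 1 -> H (1, t) = g t &
      forall s, 0 <= s <= 1 -> H (s, 0) = x /\ H (s, 1) = y].

Definition concat f g : R -> T :=
  fun t => if t <= 2^-1 then f (2 * t) else g (2 * t - 1).

Definition reverse f : R -> T := fun t => f (1 - t).

Lemma within_comp (U V : topologicalType) (A : set U) (B : set V)
  (f : U -> T) (g : V -> U) :
  {within A, continuous f} -> continuous g -> B `<=` g @^-1` A ->
  {within B, continuous (f \o g)}.
Proof.
move=> cf cg sBA; apply/subspace_continuousP => v Bv.
move/subspace_continuousP : cf => /(_ (g v) (sBA _ Bv)) cf.
apply: cvg_comp cf => P; rewrite /within /= => nP.
have := cg v _ nP; rewrite /nbhs /=.
by apply: filterS => w /= Pw Bw; apply: Pw; apply: sBA.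
Qed.

Lemma within_eq (U : topologicalType) (A : set U) (f g : U -> T) :
  (forall t, A t -> f t = g t) ->
  {within A, continuous f} -> {within A, continuous g}.
Proof.
move=> fg cf; apply: (subspace_eq_continuous _ cf) => t At.
by apply: fg; rewrite inE in At.
Qed.

Lemma contIaff (a b : R) : continuous (fun t : R => a * t + b).
Proof.
move=> t; apply: cvgD; last exact: cvg_cst.
by apply: cvgM; [exact: cvg_cst|exact: cvg_id].
Qed.

Lemma contMax (V : topologicalType) (f g : V -> R) :
  continuous f -> continuous g -> continuous (fun t => Num.max (f t) (g t)).
Proof. by move=> cf cg t; apply: (@continuous_max R V f g t); [exact: cf|exact: cg]. Qed.

Lemma contMin (V : topologicalType) (f g : V -> R) :
  continuous f -> continuous g -> continuous (fun t => Num.min (f t) (g t)).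
Proof. by move=> cf cg t; apply: (@continuous_min R V f g t); [exact: cf|exact: cg]. Qed.

Lemma le1half : (1 <= 2^-1 :> R) = false.
Proof. by apply/negbTE; rewrite -ltNge; lra. Qed.

Lemma half2 : 2 * 2^-1 = 1 :> R.
Proof. by lra. Qed.

Lemma twoB1 : 2 - 1 = 1 :> R.
Proof. by lra. Qed.

Lemma split_half : `[0, 1] = `[0, 2^-1] `|` `[2^-1, 1] :> set R.
Proof.
apply/seteqP; split => t /=; rewrite !in_itv /=.
  by move=> /andP[? ?]; case: (lerP t 2^-1) => ?; [left|right]; apply/andP; split; lra.
by case=> /andP[? ?]; apply/andP; split; lra.
Qed.

Lemma path_concat x y z f g :
  is_path x y f -> is_path y z g -> is_path x z (concat f g).
Proof.
move=> [cf f0 f1] [cg g0 g1]; split; last 2 first.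
- by rewrite /concat mulr0 invr_ge0 ler0n.
- by rewrite /concat mulr1 le1half twoB1.
rewrite split_half.
apply: withinU_continuous; [exact: interval_closed|exact: interval_closed| |].
  apply: (@within_eq _ _ (f \o (fun t => 2 * t + 0))).
    by move=> t /=; rewrite in_itv /= addr0 => /andP[_ h]; rewrite /concat h.
  apply: (within_comp cf); first exact: contIaff.
  by move=> t /=; rewrite !in_itv /= => /andP[? ?]; apply/andP; split; lra.
apply: (@within_eq _ _ (g \o (fun t => 2 * t + -1))).
  move=> t /=; rewrite in_itv /= => /andP[h _]; rewrite /concat.
  case: (lerP t 2^-1) => // h'; have -> : t = 2^-1 by lra.
  by rewrite half2 subrr f1 g0.
apply: (within_comp cg); first exact: contIaff.
by move=> t /=; rewrite !in_itv /= => /andP[? ?]; apply/andP; split; lra.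
Qed.

Lemma path_reverse x y f : is_path x y f -> is_path y x (reverse f).
Proof.
move=> [cf f0 f1]; split; last 2 first.
- by rewrite /reverse subr0.
- by rewrite /reverse subrr.
apply: (@within_eq _ _ (f \o (fun t => -1 * t + 1))).
  by move=> t _ /=; rewrite /reverse mulN1r addrC.
apply: (within_comp cf); first exact: contIaff.
by move=> t /=; rewrite !in_itv /= => /andP[? ?]; apply/andP; split; lra.
Qed.

Lemma path_cst x : is_path x x (cst x).
Proof. by split=> //; apply: continuous_subspaceT; apply: cst_continuous. Qed.

Lemma closed_fst (A : set R) : closed A -> closed (A `*` setT : set (R * R)).
Proof.
move=> cA; rewrite (_ : _ `*` _ = fst @^-1` A); last first.
  by apply/seteqP; split => -[a b] //= [].
by apply: closed_comp => //= p _; exact: cvg_fst.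
Qed.

Lemma closed_snd (A : set R) : closed A -> closed (setT `*` A : set (R * R)).
Proof.
move=> cA; rewrite (_ : _ `*` _ = snd @^-1` A); last first.
  by apply/seteqP; split => -[a b] //= [].
by apply: closed_comp => //= p _; exact: cvg_snd.
Qed.

Lemma closed_rect (A B : set R) : closed A -> closed B ->
  closed (A `*` B : set (R * R)).
Proof.
move=> cA cB; rewrite (_ : _ `*` _ = (A `*` setT) `&` (setT `*` B)).
  by apply: closedI; [exact: closed_fst|exact: closed_snd].
by apply/seteqP; split => -[a b] /=; [move=> []|move=> [[] ? ? []]].
Qed.

Lemma cont_affp (a b c : R) : continuous (fun p : R * R => a * p.1 + b * p.2 + c).
Proof.
move=> p; apply: cvgD; last exact: cvg_cst.
apply: cvgD; (apply: cvgM; [exact: cvg_cst|]); [exact: cvg_fst|exact: cvg_snd].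
Qed.

Lemma cont_pair (V : topologicalType) (f g : V -> R) :
  continuous f -> continuous g -> continuous (fun v => (f v, g v)).
Proof. by move=> cf cg v; exact: (cvg_pair (cf v) (cg v)). Qed.

Lemma homotopic_refl x y f : is_path x y f -> homotopic x y f f.
Proof.
move=> [cf f0 f1]; exists (f \o snd); split=> //.
apply: (within_comp cf); first by move=> p; exact: cvg_snd.
by move=> [a b] [].
Qed.

Lemma homotopic_sym x y f g : homotopic x y f g -> homotopic x y g f.
Proof.
move=> [H [cH H0 H1 He]].
exists (H \o (fun p => (-1 * p.1 + 0 * p.2 + 1, p.2))); split.
- apply: (within_comp cH).
    by apply: cont_pair; [exact: cont_affp|move=> p; exact: cvg_snd].
  move=> [a b] /= []; rewrite !in_itv /= => /andP[? ?] hb.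
  by split=> //; apply/andP; split; lra.
- by move=> t ht /=; rewrite mulr0 mul0r !add0r H1.
- by move=> t ht /=; rewrite mulr1 mul0r addr0 addNr H0.
- move=> s /andP[? ?] /=; have hs : 0 <= -1 * s + 1 <= 1 by apply/andP; split; lra.
  by have := He _ hs; rewrite !(mul0r, mulr0, addr0).
Qed.

Lemma homotopic_trans x y f g h :
  homotopic x y f g -> homotopic x y g h -> homotopic x y f h.
Proof.
move=> [H [cH H0 H1 He]] [G [cG G0 G1 Ge]].
exists (fun p => if p.1 <= 2^-1 then H (2 * p.1, p.2) else G (2 * p.1 - 1, p.2)).
split.
- have -> : `[0, 1] `*` `[0, 1] =
      (`[0, 2^-1] `*` `[0, 1]) `|` (`[2^-1, 1] `*` `[0, 1]) :> set (R * R).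
    by rewrite {1}split_half; apply/seteqP; split=> -[a b] /=; tauto.
  have cI (a b : R) : closed (`[a, b] : set R) by exact: interval_closed.
  apply: withinU_continuous; [exact: closed_rect|exact: closed_rect| |].
    apply: (@within_eq _ _ (H \o (fun p => (2 * p.1 + 0 * p.2 + 0, p.2)))).
      move=> [a b] /= []; rewrite !in_itv /= => /andP[_ ->] _.
      by rewrite mul0r !addr0.
    apply: (within_comp cH).
      by apply: cont_pair; [exact: cont_affp|move=> p; exact: cvg_snd].
    move=> [a b] /= []; rewrite !in_itv /= => /andP[? ?] hb.
    by split=> //; apply/andP; split; lra.
  apply: (@within_eq _ _ (G \o (fun p => (2 * p.1 + 0 * p.2 + -1, p.2)))).
    move=> [a b] /= []; rewrite !in_itv /= => /andP[h' _] hb.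
    rewrite mul0r addr0; case: (lerP a 2^-1) => // h2.
    have -> : a = 2^-1 by lra.
    by rewrite half2 subrr G0 ?H1.
  apply: (within_comp cG).
    by apply: cont_pair; [exact: cont_affp|move=> p; exact: cvg_snd].
  move=> [a b] /= []; rewrite !in_itv /= => /andP[? ?] hb.
  by split=> //; apply/andP; split; lra.
- by move=> t ht /=; rewrite invr_ge0 ler0n mulr0 H0.
- move=> t ht /=; by rewrite le1half mulr1 twoB1 G1.
- move=> s /andP[? ?] /=; case: (lerP s 2^-1) => hs.
    by apply: He; apply/andP; split; lra.
  by apply: Ge; apply/andP; split; lra.
Qed.

Lemma homotopic_concat x y z f f' g g' :
  homotopic x y f f' -> homotopic y z g g' ->
  homotopic x z (concat f g) (concat f' g').
Proof.
move=> [H [cH H0 H1 He]] [G [cG G0 G1 Ge]].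
exists (fun p => if p.2 <= 2^-1 then H (p.1, 2 * p.2) else G (p.1, 2 * p.2 - 1)).
split.
- have -> : `[0, 1] `*` `[0, 1] =
      (`[0, 1] `*` `[0, 2^-1]) `|` (`[0, 1] `*` `[2^-1, 1]) :> set (R * R).
    by rewrite {2}split_half; apply/seteqP; split=> -[a b] /=; tauto.
  have cI (a b : R) : closed (`[a, b] : set R) by exact: interval_closed.
  apply: withinU_continuous; [exact: closed_rect|exact: closed_rect| |].
    apply: (@within_eq _ _ (H \o (fun p => (p.1, 0 * p.1 + 2 * p.2 + 0)))).
      move=> [a b] /= []; rewrite !in_itv /= => _ /andP[_ ->].
      by rewrite mul0r add0r addr0.
    apply: (within_comp cH).
      by apply: cont_pair; [move=> p; exact: cvg_fst|exact: cont_affp].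
    move=> [a b] /= []; rewrite !in_itv /= => ha /andP[? ?].
    by split=> //; apply/andP; split; lra.
  apply: (@within_eq _ _ (G \o (fun p => (p.1, 0 * p.1 + 2 * p.2 + -1)))).
    move=> [a b] /= []; rewrite !in_itv /= => ha /andP[h' _].
    rewrite mul0r add0r; case: (lerP b 2^-1) => // h2.
    have -> : b = 2^-1 by lra.
    rewrite half2 subrr.
    have ha' : 0 <= a <= 1 by [].
    by rewrite (He _ ha').2 (Ge _ ha').1.
  apply: (within_comp cG).
    by apply: cont_pair; [move=> p; exact: cvg_fst|exact: cont_affp].
  move=> [a b] /= []; rewrite !in_itv /= => ha /andP[? ?].
  by split=> //; apply/andP; split; lra.
- move=> t /andP[? ?]; rewrite /concat /=.
  by case: (lerP t 2^-1) => h; [rewrite H0|rewrite G0] => //;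
    apply/andP; split; lra.
- move=> t /andP[? ?]; rewrite /concat /=.
  by case: (lerP t 2^-1) => h; [rewrite H1|rewrite G1] => //;
    apply/andP; split; lra.
- move=> s hs /=; rewrite invr_ge0 ler0n mulr0 (He _ hs).1; split=> //.
  by rewrite le1half mulr1 twoB1 (Ge _ hs).2.
Qed.

Lemma homotopic_reparam x y f (phi psi : R -> R) :
  {within `[0, 1], continuous f} -> continuous phi -> continuous psi ->
  (forall t, 0 <= t <= 1 -> 0 <= phi t <= 1) ->
  (forall t, 0 <= t <= 1 -> 0 <= psi t <= 1) ->
  phi 0 = psi 0 -> phi 1 = psi 1 -> f (phi 0) = x -> f (phi 1) = y ->
  homotopic x y (f \o phi) (f \o psi).
Proof.
move=> cf cphi cpsi Iphi Ipsi e0 e1 f0 f1.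
exists (f \o (fun p => (1 - p.1) * phi p.2 + p.1 * psi p.2)); split.
- apply: (within_comp cf).
    move=> p; apply: cvgD; apply: cvgM.
    + by apply: cvgB; [exact: cvg_cst|exact: cvg_fst].
    + by apply: (@continuous_comp _ _ _ snd phi); [exact: cvg_snd|exact: cphi].
    + exact: cvg_fst.
    + by apply: (@continuous_comp _ _ _ snd psi); [exact: cvg_snd|exact: cpsi].
  move=> [a b] /= []; rewrite !in_itv /= => /andP[? ?] hb.
  have /andP[? ?] := Iphi _ hb; have /andP[? ?] := Ipsi _ hb.
  by apply/andP; split; nra.
- by move=> t ht /=; rewrite subr0 mul1r mul0r addr0.
- by move=> t ht /=; rewrite subrr mul0r mul1r add0r.
- move=> s _ /=; rewrite -e0 -e1 -!mulrDl subrK !mul1r; by split.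
Qed.

Lemma homotopic_eq x y f g : is_path x y f ->
  (forall t, 0 <= t <= 1 -> f t = g t) -> homotopic x y f g.
Proof.
move=> [cf f0 f1] fg; exists (f \o snd); split=> //.
  apply: (within_comp cf); first by move=> p; exact: cvg_snd.
  by move=> [a b] [].
Qed.

Lemma path_ext x y f g :
  is_path x y f -> (forall t, 0 <= t <= 1 -> f t = g t) -> is_path x y g.
Proof.
move=> [cf f0 f1] fg; split; rewrite -?fg ?lexx ?ler01 //.
by apply: within_eq cf => t /=; rewrite in_itv /=; exact: fg.
Qed.

Lemma concatA x y z w f g h :
  is_path x y f -> is_path y z g -> is_path z w h ->
  homotopic x w (concat f (concat g h)) (concat (concat f g) h).
Proof.
move=> pf pg ph; have pg' := pg; have ph' := ph.
case: pg' => _ g0 g1; case: ph' => _ h0 h1.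
have P := path_concat pf (path_concat pg ph); have [cP P0 P1] := P.
(* phi : 0 -> 0, 1/4 -> 1/2, 1/2 -> 3/4, 1 -> 1 *)
pose phi (t : R) := Num.min (2 * t + 0) (Num.min (1 * t + 4^-1) (2^-1 * t + 2^-1)).
have cphi : continuous phi.
  by apply: contMin; [exact: contIaff|apply: contMin; exact: contIaff].
apply: (homotopic_trans (g := concat f (concat g h) \o phi)).
  apply: (@homotopic_reparam _ _ _ id phi) => //.
  - by move=> t; exact: cvg_id.
  - move=> t /andP[? ?]; rewrite /phi.
    case: (lerP (1 * t + 4^-1) (2^-1 * t + 2^-1)) => ?;
    [case: (lerP (2 * t + 0) (1 * t + 4^-1))
    |case: (lerP (2 * t + 0) (2^-1 * t + 2^-1))] => ?; apply/andP; split; lra.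
  - by rewrite /phi (min_l (y := 2^-1 * 0 + 2^-1)) ?min_l; lra.
  - by rewrite /phi (min_r (x := 1 * 1 + 4^-1)) ?min_r; lra.
apply: homotopic_sym; apply: homotopic_eq.
  exact: path_concat (path_concat pf pg) ph.
move=> t /andP[t0 t1]; rewrite /concat /= /phi.
case: (lerP t 2^-1) => ht; last first.
  rewrite (min_r (x := 1 * t + 4^-1)); last by lra.
  rewrite min_r; last by lra.
  rewrite ifF; last by apply/negbTE; rewrite -ltNge; lra.
  rewrite ifF; last by apply/negbTE; rewrite -ltNge; lra.
  by congr h; lra.
rewrite (min_l (y := 2^-1 * t + 2^-1)); last by lra.
case: (lerP (2 * t) 2^-1) => ht'.
  rewrite min_l; last by lra.
  by rewrite addr0 ifT //; lra.
rewrite min_r; last by lra.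
rewrite ifF; last by apply/negbTE; rewrite -ltNge; lra.
rewrite ifT; last by lra.
by congr g; lra.
Qed.

Lemma concat1p x y f : is_path x y f -> homotopic x y (concat (cst x) f) f.
Proof.
move=> pf; have [cf f0 f1] := pf.
apply: (homotopic_trans (g := f \o (fun t => Num.max 0 (2 * t + -1)))).
  apply: homotopic_eq; first exact: path_concat (path_cst x) pf.
  move=> t /andP[? ?]; rewrite /concat /=; case: (lerP t 2^-1) => h.
    by rewrite max_l ?f0 //; lra.
  by rewrite max_r //; lra.
apply: (@homotopic_reparam _ _ _ (fun t => Num.max 0 (2 * t + -1)) id) => //.
- by apply: contMax; [exact: cst_continuous|exact: contIaff].
- by move=> t; exact: cvg_id.
- by move=> t /andP[? ?]; case: (lerP 0 (2 * t + -1)) => ?; apply/andP; split; lra.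
- by rewrite max_l //; lra.
- by rewrite max_r //; lra.
- by rewrite max_l ?f0 //; lra.
- by rewrite max_r mulr1 twoB1 ?f1 ?ler01.
Qed.

Lemma concatp1 x y f : is_path x y f -> homotopic x y (concat f (cst y)) f.
Proof.
move=> pf; have [cf f0 f1] := pf.
apply: (homotopic_trans (g := f \o (fun t => Num.min 1 (2 * t + 0)))).
  apply: homotopic_eq; first exact: path_concat pf (path_cst y).
  move=> t /andP[? ?]; rewrite /concat /=; case: (lerP t 2^-1) => h.
    by rewrite min_r ?addr0 //; lra.
  by rewrite min_l ?f1 //; lra.
apply: (@homotopic_reparam _ _ _ (fun t => Num.min 1 (2 * t + 0)) id) => //.
- by apply: contMin; [exact: cst_continuous|exact: contIaff].
- by move=> t; exact: cvg_id.
- by move=> t /andP[? ?]; case: (lerP 1 (2 * t + 0)) => ?; apply/andP; split; lra.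
- by rewrite min_r //; lra.
- by rewrite min_l //; lra.
- by rewrite min_r ?mulr0 ?addr0 //; lra.
- by rewrite min_l //; lra.
Qed.

Lemma concatpV x y f : is_path x y f ->
  homotopic x x (concat f (reverse f)) (cst x).
Proof.
move=> pf; have [cf f0 f1] := pf.
pose phi (t : R) := Num.min (2 * t + 0) (-2 * t + 2).
have phi0 : phi 0 = 0 by rewrite /phi min_l; lra.
have phi1 : phi 1 = 0 by rewrite /phi min_r; lra.
apply: (homotopic_trans (g := f \o phi)).
  apply: homotopic_eq; first exact: path_concat pf (path_reverse pf).
  move=> t /andP[? ?]; rewrite /concat /reverse /phi /=; case: (lerP t 2^-1) => h.
    by rewrite min_l ?addr0 //; lra.
  by rewrite min_r; last (by lra); congr f; lra.
rewrite (_ : cst x = f \o cst 0); last by apply/funext => t /=; rewrite f0.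
apply: (@homotopic_reparam _ _ _ phi (cst 0)) => //.
- by apply: contMin; exact: contIaff.
- exact: cst_continuous.
- by move=> t /andP[? ?]; rewrite /phi; case: (lerP (2 * t + 0) (-2 * t + 2)) => ?; apply/andP; split; lra.
- by move=> t _; rewrite lexx ler01.
- by rewrite phi0.
- by rewrite phi1.
Qed.

Lemma reverseK f : reverse (reverse f) = f.
Proof. by apply/funext => t; rewrite /reverse opprB addrC subrK. Qed.

Lemma homotopic_reverse x y f g :
  homotopic x y f g -> homotopic y x (reverse f) (reverse g).
Proof.
move=> [H [cH H0 H1 He]].
exists (H \o (fun p => (p.1, 0 * p.1 + -1 * p.2 + 1))); split.
- apply: (within_comp cH).
    by apply: cont_pair; [move=> p; exact: cvg_fst|exact: cont_affp].
  move=> [a b] /= []; rewrite !in_itv /= => ha /andP[? ?].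
  by split=> //; apply/andP; split; lra.
- move=> t /andP[? ?]; rewrite /= mulr0 add0r.
  by rewrite H0 /reverse ?mulN1r 1?addrC //; apply/andP; split; lra.
- move=> t /andP[? ?]; rewrite /= mul0r add0r.
  by rewrite H1 /reverse ?mulN1r 1?addrC //; apply/andP; split; lra.
- move=> s hs /=; rewrite mul0r !add0r mulr0 add0r mulr1 addNr.
  by have [-> ->] := He _ hs.
Qed.

End Paths.

Section FundamentalGroup.
Context (R : realType) (T : topologicalType) (x : T).
Local Open Scope quotient_scope.

Definition loop := {f : R -> T | `[< is_path x x f >]}.

HB.instance Definition _ := Choice.on loop.
HB.instance Definition _ := SubType.on loop.

Lemma loopP (a : loop) : is_path x x (val a).
Proof. by case: a => f /= /asboolP. Qed.

Definition mkloop (f : R -> T) (pf : is_path x x f) : loop := exist _ f (asboolT pf).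

Definition cst_loop : loop := mkloop (path_cst x).
Definition concat_loop (a b : loop) : loop := mkloop (path_concat (loopP a) (loopP b)).
Definition reverse_loop (a : loop) : loop := mkloop (path_reverse (loopP a)).

Definition loop_homotopic (a b : loop) : bool := `[< homotopic x x (val a) (val b) >].

Lemma loop_homotopic_equiv : equiv_class_of loop_homotopic.
Proof.
split=> [a|a b|b a c].
- by apply/asboolP; apply: homotopic_refl; exact: loopP.
- by apply/asboolP/asboolP; exact: homotopic_sym.
- by move=> /asboolP ab /asboolP bc; apply/asboolP; exact: homotopic_trans ab bc.
Qed.

Canonical loop_homotopic_equivrel := EquivRelPack loop_homotopic_equiv.
Canonical loop_homotopic_enc := defaultEncModRel loop_homotopic.

Definition pi1 : Type := {eq_quot loop_homotopic}.

HB.instance Definition _ := Choice.on pi1.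
HB.instance Definition _ := EqQuotient.on pi1.

Lemma pi1P (a b : loop) :
  (\pi_pi1 a = \pi_pi1 b) <-> homotopic x x (val a) (val b).
Proof.
split=> [/eqP|ab]; first by rewrite eqmodE /= => /asboolP.
by apply/eqP; rewrite eqmodE; apply/asboolP.
Qed.

Lemma pi1_repr (a : loop) : homotopic x x (val (repr (\pi_pi1 a))) (val a).
Proof. by apply/pi1P; rewrite reprK. Qed.

Definition pi1_one : pi1 := \pi_pi1 cst_loop.
Definition pi1_mul (a b : pi1) : pi1 := \pi_pi1 (concat_loop (repr a) (repr b)).
Definition pi1_inv (a : pi1) : pi1 := \pi_pi1 (reverse_loop (repr a)).

Lemma pi1_mulE a b : pi1_mul (\pi_pi1 a) (\pi_pi1 b) = \pi_pi1 (concat_loop a b).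
Proof. by apply/pi1P; apply: homotopic_concat; exact: pi1_repr. Qed.

Lemma pi1_invE a : pi1_inv (\pi_pi1 a) = \pi_pi1 (reverse_loop a).
Proof. by apply/pi1P; apply: homotopic_reverse; exact: pi1_repr. Qed.

Lemma pi1_mulA : associative pi1_mul.
Proof.
elim/quotW => a; elim/quotW => b; elim/quotW => c.
rewrite (pi1_mulE b c) (pi1_mulE a b) !pi1_mulE.
by apply/pi1P; apply: concatA; exact: loopP.
Qed.

Lemma pi1_mul1 : left_id pi1_one pi1_mul.
Proof.
by move=> a; rewrite -[a]reprK pi1_mulE; apply/pi1P; apply: concat1p; exact: loopP.
Qed.

Lemma pi1_1mul : right_id pi1_one pi1_mul.
Proof.
by move=> a; rewrite -[a]reprK pi1_mulE; apply/pi1P; apply: concatp1; exact: loopP.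
Qed.

Lemma pi1_mulV : right_inverse pi1_one pi1_inv pi1_mul.
Proof.
move=> a; rewrite -[a]reprK pi1_invE pi1_mulE; apply/pi1P.
by apply: concatpV; exact: loopP.
Qed.

Lemma pi1_mulVl : left_inverse pi1_one pi1_inv pi1_mul.
Proof.
move=> a; rewrite -[a]reprK pi1_invE pi1_mulE; apply/pi1P => /=.
by rewrite -{2}(reverseK (val (repr a))); apply: concatpV; apply: path_reverse; exact: loopP.
Qed.

HB.instance Definition _ :=
  isGroup.Build pi1 pi1_mulA pi1_mul1 pi1_1mul pi1_mulVl pi1_mulV.

(* The class of f, which is meant to be a loop at x.                           *)
Definition pi1_class (f : R -> T) : pi1 := \pi_pi1 (insubd cst_loop f).

End FundamentalGroup.

Section GroupAlgebra.
Context (R : comNzRingType) (G : groupType).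

Definition finitely_supported : {pred G -> R^o} :=
  fun f => `[< finite_set [set g | f g != 0] >].

Lemma finitely_supported_submod : submod_closed finitely_supported.
Proof.
split.
  apply/asboolP; rewrite (_ : mkset _ = set0)%classic //.
  by apply/seteqP; split=> x //=; rewrite eqxx.
move=> a f h /asboolP ff /asboolP fh; apply/asboolP.
apply: (@sub_finite_set _ _
  ([set g | f g != 0] `|` [set g | h g != 0])%classic); last by rewrite finite_setU.
move=> g /=; apply: contraPP => /not_orP[/negP + /negP].
rewrite !negbK => /eqP fg /eqP hg /negP; apply.
by rewrite /GRing.add /GRing.scale /= fg hg /GRing.scale /= mulr0 addr0.
Qed.

HB.instance Definition _ :=
  GRing.isSubmodClosed.Build R (G -> R^o) finitely_supported finitely_supported_submod.

Definition group_algebra := {f : G -> R^o | finitely_supported f}.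

HB.instance Definition _ := Choice.on group_algebra.
HB.instance Definition _ := SubType.on group_algebra.
HB.instance Definition _ := [SubChoice_isSubLmodule of group_algebra by <:].

Implicit Types f h k : group_algebra.

Definition ga_coef f (g : G) : R := val f g.

Lemma ga_coefD f h g : ga_coef (f + h) g = ga_coef f g + ga_coef h g.
Proof. by []. Qed.

Lemma ga_coefZ a f g : ga_coef (a *: f) g = a * ga_coef f g.
Proof. by []. Qed.

Lemma ga_coef0 g : ga_coef 0 g = 0.
Proof. by []. Qed.

Lemma ga_coef_sum (I : Type) (r : seq I) (P : pred I) (F : I -> group_algebra) g :
  ga_coef (\sum_(i <- r | P i) F i) g = \sum_(i <- r | P i) ga_coef (F i) g.
Proof. by elim/big_rec2 : _ => [|i a b _ <-]; rewrite ?ga_coef0 ?ga_coefD. Qed.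

Lemma ga_eqP f h : (forall g, ga_coef f g = ga_coef h g) <-> f = h.
Proof. by split=> [fh|->//]; apply: val_inj; apply/funext. Qed.

Definition ga_supp f : seq G := fset_set [set g | ga_coef f g != 0]%classic.

Lemma mem_ga_supp f g : (g \in ga_supp f) = (ga_coef f g != 0).
Proof.
rewrite in_fset_set; last by have /asboolP := valP f.
by apply/idP/idP => [/set_mem|h]; last exact/mem_set.
Qed.

Lemma ga_supp_uniq f : uniq (ga_supp f).
Proof. exact: fset_uniq. Qed.

Lemma ga_single_subproof (g : G) : finitely_supported (fun h : G => (h == g)%:R).
Proof.
apply/asboolP; apply: (@sub_finite_set _ _ [set g]%classic) => // h /=.
by have [//|_] := eqVneq h g => /negP []; apply/eqP.
Qed.

Definition ga_single (g : G) : group_algebra :=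
  exist (fun u : G -> R^o => finitely_supported u) _ (ga_single_subproof g).

Lemma ga_coef_single g (h : G) : ga_coef (ga_single g) h = (h == g)%:R.
Proof. by []. Qed.

Lemma ga_expand f (s : seq G) : uniq s -> {subset ga_supp f <= s} ->
  f = \sum_(g <- s) ga_coef f g *: ga_single g.
Proof.
move=> us sfs; apply/ga_eqP => h; rewrite ga_coef_sum.
have [hs|hs] := boolP (h \in s).
  rewrite (bigD1_seq h) //= ga_coefZ ga_coef_single eqxx mulr1 big1 ?addr0 // => i /negbTE ih.
  by rewrite ga_coefZ ga_coef_single eq_sym ih mulr0.
rewrite big1_seq.
  by apply/eqP; rewrite -[_ == _]negbK -mem_ga_supp; apply: contra hs; exact: sfs.
move=> i /= si; rewrite ga_coefZ ga_coef_single; case: eqVneq => [hi|]; last by rewrite mulr0.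
by rewrite hi si in hs.
Qed.

Lemma ga_translate_subproof (a : G) f :
  finitely_supported (fun h : G => ga_coef f (a^-1 * h)%g).
Proof.
apply/asboolP.
apply: (@sub_finite_set _ _ ((fun h : G => a * h)%g @` [set g | ga_coef f g != 0])%classic).
  by move=> h /= fh; exists (a^-1 * h)%g => //; rewrite mulgA mulgV mul1g.
by apply: finite_image; have /asboolP := valP f.
Qed.

Definition ga_translate a f : group_algebra :=
  exist (fun u : G -> R^o => finitely_supported u) _ (ga_translate_subproof a f).

Lemma ga_coef_translate a f g : ga_coef (ga_translate a f) g = ga_coef f (a^-1 * g)%g.
Proof. by []. Qed.

(* (f h)(x) = \sum_g f(g) h(g^-1 x)                                           *)
Definition ga_mul f h := \sum_(g <- ga_supp f) ga_coef f g *: ga_translate g h.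

Lemma ga_mulE f h (s : seq G) : uniq s -> {subset ga_supp f <= s} ->
  ga_mul f h = \sum_(g <- s) ga_coef f g *: ga_translate g h.
Proof.
move=> us sfs; rewrite /ga_mul [RHS](bigID (mem (ga_supp f))) /= [X in _ + X]big1 ?addr0.
  rewrite -[RHS]big_filter; apply: perm_big; apply: uniq_perm; rewrite ?filter_uniq ?ga_supp_uniq //.
  by move=> g; rewrite mem_filter; apply/idP/andP => [fg|[]//]; split=> //; exact: sfs.
by move=> g; rewrite mem_ga_supp negbK => /eqP ->; rewrite scale0r.
Qed.

Lemma ga_translateD a f h : ga_translate a (f + h) = ga_translate a f + ga_translate a h.
Proof. exact/ga_eqP. Qed.

Lemma ga_translateZ a c f : ga_translate a (c *: f) = c *: ga_translate a f.
Proof. exact/ga_eqP. Qed.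

Lemma ga_translate_sum a (I : Type) (r : seq I) (F : I -> group_algebra) :
  ga_translate a (\sum_(i <- r) F i) = \sum_(i <- r) ga_translate a (F i).
Proof.
elim: r => [|i r IH]; first by rewrite !big_nil; exact/ga_eqP.
by rewrite !big_cons ga_translateD IH.
Qed.

Lemma ga_translateM a b f : ga_translate a (ga_translate b f) = ga_translate (a * b)%g f.
Proof. by apply/ga_eqP => g; rewrite !ga_coef_translate invMg mulgA. Qed.

Lemma ga_translate1 f : ga_translate 1%g f = f.
Proof. by apply/ga_eqP => g; rewrite ga_coef_translate invg1 mul1g. Qed.

Lemma ga_translate_single a b : ga_translate a (ga_single b) = ga_single (a * b)%g.
Proof.
apply/ga_eqP => g; rewrite ga_coef_translate !ga_coef_single; congr (nat_of_bool _)%:R.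
by apply/eqP/eqP => [<-|->]; rewrite mulgA ?mulgV ?mulVg mul1g.
Qed.

Lemma ga_mulDr f h k : ga_mul f (h + k) = ga_mul f h + ga_mul f k.
Proof. by rewrite -big_split; apply: eq_bigr => g _; rewrite ga_translateD scalerDr. Qed.

Lemma ga_mulZr c f h : ga_mul f (c *: h) = c *: ga_mul f h.
Proof.
by rewrite scaler_sumr; apply: eq_bigr => g _; rewrite ga_translateZ !scalerA mulrC.
Qed.

Lemma ga_mulDl f h k : ga_mul (f + h) k = ga_mul f k + ga_mul h k.
Proof.
pose s := undup (ga_supp f ++ ga_supp h).
have us : uniq s by exact: undup_uniq.
rewrite !(@ga_mulE _ k s us).
- rewrite -big_split; apply: eq_bigr => g _; rewrite /=. by rewrite -scalerDl.
- by move=> g hg; rewrite mem_undup mem_cat hg orbT.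
- by move=> g hg; rewrite mem_undup mem_cat hg.
- move=> g; rewrite mem_undup mem_cat !mem_ga_supp ga_coefD.
  by apply: contraNT; rewrite negb_or !negbK => /andP[/eqP-> /eqP->]; rewrite addr0.
Qed.

Lemma ga_mulZl c f h : ga_mul (c *: f) h = c *: ga_mul f h.
Proof.
rewrite (@ga_mulE _ h (ga_supp f)) ?ga_supp_uniq //.
  by rewrite scaler_sumr; apply: eq_bigr => g _; rewrite scalerA.
move=> g; rewrite !mem_ga_supp ga_coefZ; apply: contraNneq => ->.
by rewrite mulr0.
Qed.

Lemma ga_mul_single g h : ga_mul (ga_single g) h = ga_translate g h.
Proof.
rewrite (@ga_mulE _ h [:: g]) //; last first.
  by move=> x; rewrite mem_ga_supp ga_coef_single inE; case: (eqVneq x g) => // _ /=; rewrite mulr0n eqxx.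
by rewrite big_seq1 ga_coef_single eqxx scale1r.
Qed.

Lemma ga_mul0l h : ga_mul 0 h = 0.
Proof. by have := ga_mulZl 0 0 h; rewrite !scale0r. Qed.

Lemma ga_mul_suml (I : Type) (r : seq I) (F : I -> group_algebra) h :
  ga_mul (\sum_(i <- r) F i) h = \sum_(i <- r) ga_mul (F i) h.
Proof.
elim: r => [|i r IH]; first by rewrite !big_nil ga_mul0l.
by rewrite !big_cons ga_mulDl IH.
Qed.

Lemma ga_translate_mul a f h : ga_mul (ga_translate a f) h = ga_translate a (ga_mul f h).
Proof.
have -> : ga_translate a (ga_mul f h) =
    \sum_(g <- ga_supp f) ga_coef f g *: ga_translate (a * g)%g h.
  rewrite /ga_mul ga_translate_sum; apply: eq_bigr => g _.
  by rewrite ga_translateZ ga_translateM.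
rewrite {1}(@ga_expand f (ga_supp f)) ?ga_supp_uniq // ga_translate_sum ga_mul_suml.
by apply: eq_bigr => g _; rewrite ga_translateZ ga_mulZl ga_translate_single ga_mul_single.
Qed.

Lemma ga_mulA : associative ga_mul.
Proof.
move=> f h k; rewrite {2}/ga_mul ga_mul_suml; apply: eq_bigr => g _.
by rewrite ga_mulZl ga_translate_mul.
Qed.

Lemma ga_mul1l : left_id (ga_single 1%g) ga_mul.
Proof. by move=> f; rewrite ga_mul_single ga_translate1. Qed.

Lemma ga_mul1r : right_id (ga_single 1%g) ga_mul.
Proof.
move=> f; rewrite [RHS](@ga_expand f (ga_supp f)) ?ga_supp_uniq //.
by apply: eq_bigr => g _; rewrite ga_translate_single mulg1.
Qed.

Lemma ga_one_neq0 : ga_single 1%g != 0.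
Proof.
apply/eqP => /ga_eqP /(_ 1%g); rewrite ga_coef_single eqxx ga_coef0.
by move/eqP; rewrite oner_eq0.
Qed.

HB.instance Definition _ := GRing.Zmodule_isNzRing.Build group_algebra
  ga_mulA ga_mul1l ga_mul1r ga_mulDl (fun f => ga_mulDr f) ga_one_neq0.

HB.instance Definition _ := GRing.Lmodule_isLalgebra.Build R group_algebra
  (fun c f h => esym (ga_mulZl c f h)).

HB.instance Definition _ := GRing.Lalgebra_isAlgebra.Build R group_algebra
  (fun c f h => esym (ga_mulZr c f h)).

Lemma ga_singleM a b : ga_single (a * b)%g = ga_single a * ga_single b.
Proof. by rewrite [RHS]ga_mul_single ga_translate_single. Qed.

End GroupAlgebra.

Section Laurent.
Context (R : comNzRingType) (I : finType).

(* R[u_i, u_i^-1]_(i : I) as the group algebra of the group Z^I of exponents,  *)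
(* written multiplicatively.                                                  *)
Definition exponents := {ffun I -> int}.

HB.instance Definition _ := Choice.on exponents.

Definition exponent_mul (k l : exponents) : exponents := [ffun i => k i + l i].
Definition exponent_one : exponents := [ffun=> 0].
Definition exponent_inv (k : exponents) : exponents := [ffun i => - k i].

Lemma exponent_mulA : associative exponent_mul.
Proof. by move=> k l n; apply/ffunP => i; rewrite !ffunE addrA. Qed.
Lemma exponent_mulC : commutative exponent_mul.
Proof. by move=> k l; apply/ffunP => i; rewrite !ffunE addrC. Qed.
Lemma exponent_mul1 : left_id exponent_one exponent_mul.
Proof. by move=> k; apply/ffunP => i; rewrite !ffunE add0r. Qed.
Lemma exponent_1mul : right_id exponent_one exponent_mul.
Proof. by move=> k; rewrite exponent_mulC exponent_mul1. Qed.
Lemma exponent_mulV : left_inverse exponent_one exponent_inv exponent_mul.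
Proof. by move=> k; apply/ffunP => i; rewrite !ffunE addNr. Qed.
Lemma exponent_mulVr : right_inverse exponent_one exponent_inv exponent_mul.
Proof. by move=> k; rewrite exponent_mulC exponent_mulV. Qed.

HB.instance Definition _ := isGroup.Build exponents
  exponent_mulA exponent_mul1 exponent_1mul exponent_mulV exponent_mulVr.

Definition laurent := group_algebra R exponents.

HB.instance Definition _ := GRing.Algebra.on laurent.

Lemma laurent_mulC : commutative (@GRing.mul laurent).
Proof.
move=> f h; rewrite [f](@ga_expand _ _ f (ga_supp f)) ?ga_supp_uniq //.
rewrite mulr_suml mulr_sumr; apply: eq_bigr => a _.
rewrite [h](@ga_expand _ _ h (ga_supp h)) ?ga_supp_uniq //.
rewrite mulr_suml mulr_sumr; apply: eq_bigr => b _.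
rewrite -!scalerAl -!scalerAr -!ga_singleM !scalerA [_ * ga_coef h b]mulrC.
by congr (_ *: ga_single _ _); exact: exponent_mulC.
Qed.

HB.instance Definition _ := GRing.PzRing_hasCommutativeMul.Build laurent laurent_mulC.

Definition laurent_var (i : I) : laurent := ga_single R ([ffun l => (l == i)%:R] : exponents).

(* The automorphism u_i |-> u_i^-1.                                           *)
Definition laurent_inv (f : laurent) : laurent :=
  \sum_(k <- ga_supp f) ga_coef f k *: ga_single R (k^-1)%g.

End Laurent.

Section QuotientAlgebra.
Context (R : comNzRingType) (A : algType R) (X : set A).
Local Open Scope quotient_scope.

Definition two_sided_ideal (J : set A) : Prop :=
  [/\ J 0, forall a b, J a -> J b -> J (a + b) & forall c a d, J a -> J (c * a * d)].

Definition ideal_generated : set A :=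
  fun a => forall J, two_sided_ideal J -> (X `<=` J)%classic -> J a.

Lemma ideal_generatedP : two_sided_ideal ideal_generated.
Proof.
split=> [J []//|a b Ja Jb J iJ XJ|c a d Ja J iJ XJ]; have [_ JD JM] := iJ.
- by apply: JD; [exact: Ja|exact: Jb].
- by apply: JM; exact: Ja.
Qed.

Let ideal0 : ideal_generated 0. Proof. by have [] := ideal_generatedP. Qed.
Let idealD a b : ideal_generated a -> ideal_generated b -> ideal_generated (a + b).
Proof. by have [_ + _] := ideal_generatedP; exact. Qed.
Let idealM c a d : ideal_generated a -> ideal_generated (c * a * d).
Proof. by have [_ _] := ideal_generatedP; exact. Qed.
Let idealN a : ideal_generated a -> ideal_generated (- a).
Proof. by move=> /(@idealM (-1) a 1); rewrite mulr1 mulN1r. Qed.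
Let idealZ c a : ideal_generated a -> ideal_generated (c *: a).
Proof. by move=> /(@idealM (c%:A) a 1); rewrite mulr1 -scalerAl mul1r. Qed.

Definition ideal_equiv (a b : A) : bool := `[< ideal_generated (a - b) >].

Lemma ideal_equiv_class : equiv_class_of ideal_equiv.
Proof.
split=> [a|a b|b a c].
- by apply/asboolP; rewrite subrr.
- by apply/asboolP/asboolP => /idealN; rewrite opprB.
- move=> /asboolP ab /asboolP bc; apply/asboolP.
  by rewrite -[a](subrK b) -addrA; exact: idealD.
Qed.

Canonical ideal_equiv_equiv := EquivRelPack ideal_equiv_class.
Canonical ideal_equiv_enc := defaultEncModRel ideal_equiv.

Definition quotient_algebra : Type := {eq_quot ideal_equiv}.
Local Notation Q := quotient_algebra.

HB.instance Definition _ := Choice.on Q.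
HB.instance Definition _ := EqQuotient.on Q.

Definition quotient_map (a : A) : Q := \pi_Q a.

Lemma quotient_mapP a b : quotient_map a = quotient_map b <-> ideal_generated (a - b).
Proof.
split=> [/eqP|ab]; first by rewrite eqmodE => /asboolP.
by apply/eqP; rewrite eqmodE; apply/asboolP.
Qed.

Lemma quotient_map_surj (P : Q -> Prop) : (forall a, P (quotient_map a)) -> forall x, P x.
Proof. by move=> h x; rewrite -[x]reprK; exact: h. Qed.

Let repr_map a : ideal_generated (repr (quotient_map a) - a).
Proof. by apply/quotient_mapP; rewrite /quotient_map reprK. Qed.

Definition quotient_add (x y : Q) : Q := quotient_map (repr x + repr y).
Definition quotient_opp (x : Q) : Q := quotient_map (- repr x).
Definition quotient_mul (x y : Q) : Q := quotient_map (repr x * repr y).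
Definition quotient_scale (c : R) (x : Q) : Q := quotient_map (c *: repr x).

Let mapD a b : quotient_add (quotient_map a) (quotient_map b) = quotient_map (a + b).
Proof. by apply/quotient_mapP; rewrite opprD addrACA; exact: idealD. Qed.
Let mapN a : quotient_opp (quotient_map a) = quotient_map (- a).
Proof. by apply/quotient_mapP; rewrite -opprD; exact: idealN. Qed.
Let mapZ c a : quotient_scale c (quotient_map a) = quotient_map (c *: a).
Proof. by apply/quotient_mapP; rewrite -scalerBr; exact: idealZ. Qed.
Let mapM a b : quotient_mul (quotient_map a) (quotient_map b) = quotient_map (a * b).
Proof.
apply/quotient_mapP; set a' := repr _; set b' := repr _.
rewrite (_ : _ - _ = 1 * (a' - a) * b' + a * (b' - b) * 1).
  by apply: idealD; apply: idealM; exact: repr_map.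
by rewrite mul1r mulr1 mulrBl mulrBr addrA subrK.
Qed.

Lemma quotient_addA : associative quotient_add.
Proof.
elim/quotient_map_surj => a; elim/quotient_map_surj => b; elim/quotient_map_surj => c.
by rewrite (mapD b c) (mapD a b) !mapD addrA.
Qed.
Lemma quotient_addC : commutative quotient_add.
Proof. by move=> x y; rewrite /quotient_add addrC. Qed.
Lemma quotient_add0 : left_id (quotient_map 0) quotient_add.
Proof. by elim/quotient_map_surj => a; rewrite mapD add0r. Qed.
Lemma quotient_addN : left_inverse (quotient_map 0) quotient_opp quotient_add.
Proof. by elim/quotient_map_surj => a; rewrite (mapN a) mapD addNr. Qed.

HB.instance Definition _ :=
  GRing.isZmodule.Build Q quotient_addA quotient_addC quotient_add0 quotient_addN.

Lemma quotient_mulA : associative quotient_mul.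
Proof.
elim/quotient_map_surj => a; elim/quotient_map_surj => b; elim/quotient_map_surj => c.
by rewrite (mapM b c) (mapM a b) !mapM mulrA.
Qed.
Lemma quotient_mul1 : left_id (quotient_map 1) quotient_mul.
Proof. by elim/quotient_map_surj => a; rewrite mapM mul1r. Qed.
Lemma quotient_1mul : right_id (quotient_map 1) quotient_mul.
Proof. by elim/quotient_map_surj => a; rewrite mapM mulr1. Qed.
Lemma quotient_mulDl : left_distributive quotient_mul +%R.
Proof.
elim/quotient_map_surj => a; elim/quotient_map_surj => b; elim/quotient_map_surj => c.
rewrite (mapM a c) (mapM b c) [RHS]mapD.
by rewrite [X in quotient_mul X _]mapD mapM mulrDl.
Qed.
Lemma quotient_mulDr : right_distributive quotient_mul +%R.
Proof.
elim/quotient_map_surj => a; elim/quotient_map_surj => b; elim/quotient_map_surj => c.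
rewrite (mapM a c) (mapM a b) [RHS]mapD.
by rewrite [X in quotient_mul _ X]mapD mapM mulrDr.
Qed.

HB.instance Definition _ := GRing.Zmodule_isPzRing.Build Q
  quotient_mulA quotient_mul1 quotient_1mul quotient_mulDl quotient_mulDr.

Lemma quotient_scaleA a b x :
  quotient_scale a (quotient_scale b x) = quotient_scale (a * b) x.
Proof.
by elim/quotient_map_surj : x => x; rewrite (mapZ b x) !mapZ scalerA.
Qed.
Lemma quotient_scale1 : left_id 1 quotient_scale.
Proof. by elim/quotient_map_surj => x; rewrite mapZ scale1r. Qed.
Lemma quotient_scaleDr : right_distributive quotient_scale +%R.
Proof.
move=> c; elim/quotient_map_surj => a; elim/quotient_map_surj => b.
rewrite (mapZ c a) (mapZ c b) [RHS]mapD.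
by rewrite [X in quotient_scale _ X]mapD mapZ scalerDr.
Qed.
Lemma quotient_scaleDl x : {morph quotient_scale^~ x : a b / a + b}.
Proof.
move=> a b; elim/quotient_map_surj : x => x.
by rewrite (mapZ a x) (mapZ b x) [RHS]mapD mapZ scalerDl.
Qed.

HB.instance Definition _ := GRing.Zmodule_isLmodule.Build R Q
  quotient_scaleA quotient_scale1 quotient_scaleDr quotient_scaleDl.

Lemma quotient_mapD a b : quotient_map (a + b) = quotient_map a + quotient_map b.
Proof. by rewrite -[LHS]mapD. Qed.
Lemma quotient_mapM a b : quotient_map (a * b) = quotient_map a * quotient_map b.
Proof. by rewrite -[LHS]mapM. Qed.
Lemma quotient_map1 : quotient_map 1 = 1.
Proof. by []. Qed.
Lemma quotient_mapZ c a : quotient_map (c *: a) = c *: quotient_map a.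
Proof. by rewrite -[LHS]mapZ. Qed.
Lemma quotient_map_eq0 a : quotient_map a = 0 <-> ideal_generated a.
Proof. by rewrite -[0]/(quotient_map 0) quotient_mapP subr0. Qed.

End QuotientAlgebra.

(* Matrices act on column vectors from the left, for W as well as for the      *)
(* Hecke algebras.                                                            *)
Section Representations.
Context (F : fieldType) (T : Type).

Definition irreducible d (f : T -> 'M[F]_d) : Prop :=
  (0 < d)%N /\
  forall U : {vspace 'cV[F]_d},
    (forall x v, v \in U -> f x *m v \in U) -> U = 0%VS \/ U = fullv.

Definition isomorphic d e (f : T -> 'M[F]_d) (g : T -> 'M[F]_e) : Prop :=
  exists2 P : 'M[F]_(e, d), row_free P && row_full P &
    forall x, P *m f x = g x *m P.

Definition indexes_Irr (is_rep : forall d, (T -> 'M[F]_d) -> Prop)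
    (Lambda : finType) (d : Lambda -> nat)
    (rho : forall l, T -> 'M[F]_(d l)) : Prop :=
  [/\ forall l, is_rep _ (rho l) /\ irreducible (rho l),
      forall l l', isomorphic (rho l) (rho l') -> l = l' &
      forall e (f : T -> 'M[F]_e), is_rep _ f -> irreducible f ->
        exists l, isomorphic f (rho l)].

End Representations.

Section ReflectionGroup.
Context (R : realType) (K : splittingFieldType rat) (iota : {rmorphism K -> R[i]}).
Context (n : nat) (W : finGroupType) (rW : mx_representation K [set: W]%G n).
Local Notation C := (R[i] : numFieldType).

Definition fixed_points (w : W) : {vspace 'cV[K]_n} :=
  fixedSpace (linfun (mulmx (rW w))).

Definition is_pseudo_reflection (w : W) : bool := (\dim (fixed_points w)).+1 == n.

Definition hyperplane : Type :=
  seq_sub [seq fixed_points w | w <- enum W & is_pseudo_reflection w].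

HB.instance Definition _ := Finite.on hyperplane.

Definition hyperplane_space (H : hyperplane) : {vspace 'cV[K]_n} := ssval H.

Definition pointwise_stabilizer (H : hyperplane) : {set W} :=
  [set w | (hyperplane_space H <= fixed_points w)%VS].

Definition hyperplane_conj (H H' : hyperplane) : bool :=
  [exists w : W, (linfun (mulmx (rW w)) @: hyperplane_space H)%VS == hyperplane_space H'].

Definition hyperplane_orbits : {set {set hyperplane}} :=
  equivalence_partition hyperplane_conj [set: hyperplane].

Definition hyperplane_orbit : Type := {O : {set hyperplane} | O \in hyperplane_orbits}.
HB.instance Definition _ := Finite.on hyperplane_orbit.

(* All the terms of this maximum are equal.                                   *)
Definition orbit_order (O : hyperplane_orbit) : nat :=
  (\max_(H in val O) #|pointwise_stabilizer H|)%N.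

Definition expi (t : R) : R[i] := (cos t +i* sin t)%C.
Definition zetaC (d : nat) : R[i] := expi (2 * pi / d%:R).

Definition actC (w : W) (x : 'cV[C]_n) : 'cV[C]_n := map_mx iota (rW w) *m x.

(* The C-span of H in C^n.                                                    *)
Definition hyperplaneC (H : hyperplane) : set 'cV[C]_n :=
  [set x | exists c : 'I_(\dim (hyperplane_space H)) -> C,
     x = \sum_i c i *: map_mx iota (vbasis (hyperplane_space H))`_i]%classic.

Definition Vreg : set 'cV[C]_n :=
  [set x | forall H : hyperplane, ~ hyperplaneC H x]%classic.

Definition same_orbit (x y : Vreg) : bool := [exists w, actC w (val x) == val y].

Lemma actC1 x : actC 1%g x = x.
Proof. by rewrite /actC repr_mx1 map_mx1 mul1mx. Qed.

Lemma actCM w w' x : actC (w * w')%g x = actC w (actC w' x).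
Proof. by rewrite /actC repr_mxM ?inE // map_mxM mulmxA. Qed.

Lemma same_orbit_equiv : equiv_class_of same_orbit.
Proof.
split=> [x|x y|y x z].
- by apply/existsP; exists 1%g; rewrite actC1.
- by apply/existsP/existsP => -[w /eqP <-]; exists w^-1%g; rewrite -actCM mulVg actC1.
- move=> /existsP[w /eqP xy] /existsP[w' /eqP yz]; apply/existsP; exists (w' * w)%g.
  by rewrite actCM xy yz.
Qed.

Canonical same_orbit_equivrel := EquivRelPack same_orbit_equiv.
Canonical same_orbit_enc := defaultEncModRel same_orbit.

Definition orbit_space : topologicalType := quotient_topology {eq_quot same_orbit}%qT.
Definition to_orbit (x : Vreg) : orbit_space := (\pi_{eq_quot same_orbit}%qT x)%qT.

Context (x0 : Vreg).

Definition braid_group : groupType := pi1 R (to_orbit x0).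

(* Write xH = h + l with h in H and l in the line im (s - 1), where s is the   *)
(* generator of W_H of determinant exp(2 i pi / e_H).  The point xH is close to*)
(* H in the sense that the disc h + z l, |z| <= 1, meets the arrangement only  *)
(* at h, and h lies on no other hyperplane.  The arc                          *)
(* t |-> h + exp(2 i pi t / e_H) l goes from xH to s xH, so its image is a loop*)
(* in the orbit space, turning once around the image of H.                    *)
Definition monodromy_generator (O : hyperplane_orbit) (b : braid_group) : Prop :=
  exists (H : hyperplane) (s : W) (h l : 'cV[C]_n) (xH : Vreg)
         (gamma arc : R -> Vreg),
    let e := #|pointwise_stabilizer H| in
    [/\ [/\ H \in val O, s \in pointwise_stabilizer H &
           iota (\det (rW s)) = zetaC e],
        [/\ hyperplaneC H h, actC s l = zetaC e *: l & val xH = h + l],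
        (forall H', H' != H -> ~ hyperplaneC H' h) /\
        (forall z : C, z != 0 -> `|z| <= 1 -> Vreg (h + z *: l)),
        is_path x0 xH gamma /\
        (forall t, 0 <= t <= 1 ->
           val (arc t) = h + expi (2 * pi * t / e%:R) *: l) &
        b = pi1_class (to_orbit x0)
              (concat (concat (to_orbit \o gamma) (to_orbit \o arc))
                      (reverse (to_orbit \o gamma)))].

(* w is the image of b in W: the paths of class b lifted from x0 end at w x0.  *)
(* As the left factor of a concatenation is travelled first, this is a group  *)
(* morphism (and not an antimorphism) from the braid group to W.              *)
Definition lifts_to (b : braid_group) (w : W) : Prop :=
  exists (x1 : Vreg) (gamma : R -> Vreg),
    [/\ val x1 = actC w (val x0), is_path x0 x1 gamma &
        b = pi1_class (to_orbit x0) (to_orbit \o gamma)].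

Definition full_twist (b : braid_group) : Prop :=
  exists2 gamma : R -> Vreg,
    forall t, 0 <= t <= 1 -> val (gamma t) = expi (2 * pi * t) *: val x0 &
    b = pi1_class (to_orbit x0) (to_orbit \o gamma).

Definition parameter : Type := {O : hyperplane_orbit & 'I_(orbit_order O)}.
HB.instance Definition _ := Finite.on parameter.

Section HeckeAlgebra.
Context (S : comNzRingType) (u : parameter -> S).

Definition hecke_relation : set (group_algebra S braid_group) :=
  [set r | exists O s, monodromy_generator O s /\
     r = \prod_(j < orbit_order O) (ga_single S s - (u (Tagged _ j))%:A)]%classic.

Definition hecke : Type := quotient_algebra hecke_relation.
HB.instance Definition _ := GRing.Lmodule.on hecke.
HB.instance Definition _ := GRing.PzRing.on hecke.

Definition hecke_gen (b : braid_group) : hecke := quotient_map _ (ga_single S b).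

Definition hecke_rep d (f : hecke -> 'M[S]_d) : Prop :=
  [/\ linear f, f 1 = 1%:M & forall h h', f (h * h') = f h *m f h'].

End HeckeAlgebra.

Definition generic_ring : comNzRingType := laurent int parameter.
Definition generic_hecke : Type := hecke (@laurent_var int parameter : parameter -> generic_ring).
HB.instance Definition _ := GRing.Lmodule.on generic_hecke.
HB.instance Definition _ := GRing.PzRing.on generic_hecke.

(* The value of f at u_i := x_i; meaningful when all the x_i are nonzero.      *)
Definition laurent_eval (F : fieldType) (x : parameter -> F) (f : generic_ring) : F :=
  \sum_(k <- ga_supp f) (ga_coef f k)%:~R * \prod_i x i ^ (k i).

Definition free_of_rank (N : nat) : Prop :=
  exists b : 'I_N -> generic_hecke,
    forall h, exists! c : {ffun 'I_N -> generic_ring}, h = \sum_i c i *: b i.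

(* Non-degeneracy over the Laurent polynomial ring: h |-> t(h -) is an         *)
(* isomorphism from the algebra to its dual.                                  *)
Definition symmetrizing (t : {scalar generic_hecke}) : Prop :=
  (forall h h', t (h * h') = t (h' * h)) /\
  (forall f : {scalar generic_hecke}, exists! h, forall h', f h' = t (h * h')).

Context (zeta : hyperplane_orbit -> K).

Definition specialize_group (f : generic_ring) : K :=
  laurent_eval (fun i : parameter => zeta (tag i) ^+ tagged i) f.

(* The condition t(b^-1)^* = t(b pi) / t(pi) is multiplied out; z is pi.       *)
Definition canonical_symmetrizing_form (t : {scalar generic_hecke}) : Prop :=
  let T (b : braid_group) : generic_hecke := hecke_gen _ b in
  [/\ symmetrizing t,
      forall b w, lifts_to b w -> specialize_group (t (T b)) = (w == 1%g)%:R &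
      exists2 z, full_twist z &
        t (T z) <> 0 /\
        forall b, laurent_inv (t (T b^-1%g)) * t (T z) = t (T (b * z)%g)].

Definition weight : Type := forall O : hyperplane_orbit, 'I_(orbit_order O) -> int.

Definition weight_add (m m' : weight) : weight := fun O j => m O j + m' O j.

Definition ord_add e (j k : 'I_e) : 'I_e :=
  Ordinal (ltn_pmod (j + k) (leq_ltn_trans (leq0n j) (ltn_ord j))).

Definition weight_shift (g : forall O : hyperplane_orbit, 'I_(orbit_order O)) (m : weight) : weight :=
  fun O j => m O (ord_add j (g O)).

Definition weight_fixed (m : weight) : Prop :=
  forall g O j, (weight_shift g m : weight) O j = m O j.

Definition mu_order : nat :=
  #|` fset_set [set x : K | exists2 k, (0 < k)%N & x ^+ k = 1]%classic|%fset.

Local Notation "p %:F" := (tofrac p) : ring_scope.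
Local Notation Ky := {fraction {poly K}}.
Local Notation y := ('X%:F : Ky).

(* u_(O,j) = zeta^j v_(O,j)^|mu(K)|, with v_(O,j) specialized to y^m_(O,j).    *)
Definition cyclotomic_param (m : weight) (i : parameter) : Ky :=
  (zeta (tag i) ^+ tagged i)%:P%:F * (y ^ m (tag i) (tagged i)) ^+ mu_order.

(* The algebra K(y)H_m: as H(W) is given by generators and relations, its     *)
(* extension of scalars along the specialization is the algebra with the same *)
(* presentation and specialized parameters.                                   *)
Definition cyclotomic_hecke (m : weight) : Type := hecke (cyclotomic_param m).
HB.instance Definition _ m := GRing.Lmodule.on (cyclotomic_hecke m).
HB.instance Definition _ m := GRing.PzRing.on (cyclotomic_hecke m).

Definition specialized_form (t : {scalar generic_hecke}) (m : weight)
    (tm : {scalar cyclotomic_hecke m}) : Prop :=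
  forall b : braid_group,
    tm (hecke_gen _ b) = laurent_eval (cyclotomic_param m) (t (hecke_gen _ b)).

(* f is regular at y = 1, with value a.                                       *)
Definition specializes_to (f : Ky) (a : K) : Prop :=
  exists p q : {poly K}, [/\ q.[1] != 0, f = p%:F / q%:F & a = p.[1] / q.[1]].

Definition ZK_laurent (f : Ky) : Prop :=
  exists (k : nat) (p : {poly K}),
    (forall i, integralOver (intr : int -> K) p`_i) /\ f = p%:F / y ^+ k.

(* rhom l is V^l_m: it is matched with V^l by the specialization y |-> 1 of    *)
(* characters, as in Tits' deformation theorem.                               *)
Definition schur_elements (t : {scalar generic_hecke}) (Lambda : finType)
    (d : Lambda -> nat) (rho : forall l, W -> 'M[K]_(d l))
    (m : weight) (s : Lambda -> Ky) : Prop :=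
  exists (dm : Lambda -> nat) (rhom : forall l, cyclotomic_hecke m -> 'M[Ky]_(dm l))
         (tm : {scalar cyclotomic_hecke m}),
    [/\ indexes_Irr (@hecke_rep _ (cyclotomic_param m)) rhom,
        forall l b w, lifts_to b w ->
          specializes_to (\tr (rhom l (hecke_gen _ b))) (\tr (rho l w)),
        specialized_form t tm,
        forall l, s l <> 0 /\ ZK_laurent (s l) &
        forall h, tm h = \sum_l (s l)^-1 * \tr (rhom l h)].

(* Order at 0, computed from any fraction representing f.                     *)
Definition val_y (f : Ky) : int :=
  let r : {ratio {poly K}} := repr f in (mup 0 (frac r).1)%:Z - (mup 0 (frac r).2)%:Z.

Definition val_q (f : Ky) : rat := (val_y f)%:~R / mu_order%:R.

Definition a_function (s : Ky) : rat := - val_q s.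

End ReflectionGroup.

(* Main.v *)
Require Import Defs.
From HB Require Import structures.
From mathcomp Require Import all_boot all_order all_algebra all_fingroup.
From mathcomp Require Import all_field all_character.
From mathcomp Require Import generic_quotient complex finmap.
From mathcomp Require Import all_classical all_reals all_analysis.
From mathcomp Require Import ring zify.

Set Implicit Arguments.
Unset Strict Implicit.
Unset Printing Implicit Defensive.

Import Order.TTheory GRing.Theory Num.Theory.
Import numFieldNormedType.Exports.

Local Open Scope ring_scope.

(** Let B be the braid group, mu the number of roots of unity of K, and T_b the
    image of a braid b in a Hecke algebra.  Suppose that ell : B -> Z is a
    morphism with value mu n_C on the monodromy generators around C.  The
    parameters u_(C,j) of H_(m+n) are those of H_m multiplied by y^(mu n_C), and
    the defining relations are homogeneous, so T_b |-> y^(ell b) T_b is an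
    isomorphism theta from H_(m+n) onto H_m ([rescaling]).  It becomes the
    identity at y = 1.  Hence it respects the labels of the irreducible modules,
    and the Schur elements agree once theta is known to carry one symmetrizing
    form to the other.

    The morphism ell.  The trivial character of W labels a linear character of
    each of the two algebras.  On a monodromy generator it takes one of the values
    zeta^j y^(mu m_(C,j)), and j = 0 because this value is 1 at y = 1.  The
    quotient of the two linear characters is therefore y^(mu n_C) on the
    generators, and ell is its valuation ([degree_morphism]).  This replaces the
    winding number of the discriminant.

    The form.  What is needed is that t(T_b) is homogeneous of degree ell(b) when
    u_(C,j) has degree mu n_C.  This comes from the uniqueness of t.  Take a
    monomial x of degree 0 that becomes 1 under u_(C,j) |-> zeta^j, for instance
    (u_(C,0) / u_(C,1))^e.  The ring automorphism sigma that multiplies the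
    elements of degree k by x^k extends to a semilinear automorphism
    T_b |-> x^(ell b) T_b of H(W).  Transporting t along it gives a form with the
    properties that characterize t, so sigma(t(T_b)) = x^(ell b) t(T_b).  As x has
    infinite order, only the degree ell(b) occurs
    ([canonical_form_homogeneous]).

    The labels.  The pullback along theta of the module labelled k is isomorphic
    to the module labelled k' for some k'.  At y = 1 this says that the characters
    of W labelled k and k' agree at every element that lifts to a braid.  Every
    element does, because the complement of the hyperplanes is path connected
    ([lifts_exist]), and k = k' since the traces of pairwise non-isomorphic
    irreducible modules are linearly independent in characteristic 0
    ([trace_independence]).  The same independence, now over K(y), identifies the
    coefficients 1/s in the two expansions of the form of H_(m+n). *)

Local Notation "p %:F" := (tofrac p) : ring_scope.

(** * Independence of the traces of irreducible representations *)

Section Subspaces.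
Context (F : fieldType) (V : vectType F).

Definition subspace_pred (P : V -> Prop) : Prop :=
  P 0 /\ forall (c : F) u v, P u -> P v -> P (c *: u + v).

Lemma dimv_add_line (U : {vspace V}) v : v \notin U -> \dim (U + <[v]>) = (\dim U).+1.
Proof.
move=> nvU; have v0 : v != 0 by apply: contraNneq nvU => ->; exact: mem0v.
rewrite dimv_disjoint_sum ?dim_vline ?v0 ?addn1 //.
apply/eqP; rewrite -subv0; apply/subvP => w; rewrite memv_cap => /andP[wU /vlineP[c wc]].
rewrite memv0 wc; have [->|c0] := eqVneq c 0; first by rewrite scale0r.
by case/negP: nvU; rewrite -(scalerK c0 v) -wc; exact: memvZ.
Qed.

(** Submodules arise below as sets of vectors described by a formula, whereas
    irreducibility speaks of detachable subspaces.  A subspace of largest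
    dimension contained in [P] bridges the two. *)
Lemma subspace_pred_vspace (P : V -> Prop) : subspace_pred P ->
  exists U : {vspace V}, forall v, v \in U <-> P v.
Proof.
move=> [P0 PL].
pose D (k : nat) := `[< exists2 U : {vspace V}, \dim U = k & forall v, v \in U -> P v >].
have exD : exists k, D k.
  exists 0%N; apply/asboolP; exists 0%VS; first by rewrite dimv0.
  by move=> v; rewrite memv0 => /eqP ->.
have bD k : D k -> (k <= \dim (fullv : {vspace V}))%N.
  by move=> /asboolP[U <- _]; apply: dimvS; exact: subvf.
have [k /asboolP[U dU PU] kmax] := ex_maxnP exD bD.
exists U => v; split=> [/PU//|Pv]; apply: contraT => nvU.
have : (\dim (U + <[v]>) <= k)%N.
  apply: kmax; apply/asboolP; exists (U + <[v]>)%VS => // w /memv_addP[a aU [b /vlineP[c ->] ->]].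
  by rewrite addrC; apply: PL => //; exact: PU.
by rewrite dimv_add_line // dU ltnn.
Qed.
End Subspaces.

Section TraceIndependence.
Context (F : fieldType) (L : finType) (d : L -> nat) (A : Type).
Context (f : forall l, A -> 'M[F]_(d l)).

(** The tuples [(f l a)_l] form a unital subalgebra of the product of the matrix
    algebras.  Asking only this, and no algebra structure on [A], covers both the
    Hecke algebras and the linear combinations of elements of a finite group. *)
Definition jointly_closed : Prop :=
  [/\ exists a, forall l, f l a = 1%:M,
      forall c a b, exists e, forall l, f l e = c *: f l a + f l b &
      forall a b, exists e, forall l, f l e = f l a *m f l b].

Hypothesis closedf : jointly_closed.
Hypothesis irrf : forall l, irreducible (f l).
Hypothesis disjf : forall k l, isomorphic (f k) (f l) -> k = l.

Lemma irr_submodule l (P : 'cV[F]_(d l) -> Prop) :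
  subspace_pred P -> (forall a v, P v -> P (f l a *m v)) ->
  (exists2 v, P v & v <> 0) -> forall v, P v.
Proof.
move=> sP stP [v Pv v0] w; have [U UP] := subspace_pred_vspace sP.
have [_ irr] := irrf l.
have [a u|U0|UT] := irr U; first by rewrite !UP; exact: stP.
- by case: v0; apply/eqP; rewrite -memv0 -U0 UP.
- by rewrite -UP UT memvf.
Qed.

Definition left_ideal (J : A -> Prop) : Prop :=
  [/\ exists2 a, J a & forall k, f k a = 0,
      forall c a b, J a -> J b -> exists2 e, J e & forall k, f k e = c *: f k a + f k b &
      forall a b, J b -> exists2 e, J e & forall k, f k e = f k a *m f k b].

Definition annihilates (ts : seq {k & 'cV[F]_(d k)}) (b : A) : Prop :=
  forall t, t \in ts -> f (tag t) b *m tagged t = 0.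

Lemma annihilates_left_ideal ts : left_ideal (annihilates ts).
Proof.
have [[one oneE] fD fM] := closedf; split.
- have [e eE] := fD (-1) one one; exists e => [t _|j]; rewrite eE oneE scaleN1r addNr //.
  exact: mul0mx.
- move=> c x y xts yts; have [e eE] := fD c x y; exists e => // t tts.
  by rewrite eE mulmxDl -scalemxAl xts // yts // scaler0 addr0.
- move=> x y yts; have [e eE] := fM x y; exists e => // t tts.
  by rewrite eE -mulmxA yts // mulmx0.
Qed.

(** The orbit of a vector under a left ideal is a submodule, hence everything once
    it is nonzero. *)
Lemma left_ideal_orbit l (J : A -> Prop) (u : 'cV[F]_(d l)) :
  left_ideal J -> (exists2 b, J b & f l b *m u <> 0) ->
  forall w, exists2 b, J b & f l b *m u = w.
Proof.
move=> [[z Jz z0] JD JM] [b Jb bu].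
apply: (irr_submodule (P := fun w => exists2 b, J b & f l b *m u = w)).
- split; first by exists z; rewrite // z0 mul0mx.
  move=> c _ _ [b1 J1 <-] [b2 J2 <-]; have [e Je eE] := JD c _ _ J1 J2.
  by exists e; rewrite // eE mulmxDl scalemxAl.
- move=> a _ [b1 J1 <-]; have [e Je eE] := JM a _ J1.
  by exists e; rewrite // eE mulmxA.
- by exists (f l b *m u) => //; exists b.
Qed.

(** Schur's lemma: a nonzero intertwiner has zero kernel and full image. *)
Lemma intertwiner_cases k l (D : 'M[F]_(d l, d k)) :
  (forall a, D *m f k a = f l a *m D) -> D <> 0 -> k = l.
Proof.
move=> DI D0; apply: disjf.
have [u Du] : exists u : 'cV_(d k), D *m u <> 0.
  apply/not_existsP => DN; apply: D0; apply/matrixP => i j.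
  have := contrapT (DN (delta_mx j 0)); rewrite -colE => /matrixP /(_ i 0).
  by rewrite !mxE.
have Dsurj (w : 'cV_(d l)) : exists u, D *m u = w.
  apply: (irr_submodule (P := fun w => exists u, D *m u = w)).
  - split; first by exists 0; rewrite mulmx0.
    by move=> c _ _ [x <-] [z <-]; exists (c *: x + z); rewrite mulmxDr scalemxAr.
  - by move=> a _ [x <-]; exists (f k a *m x); rewrite mulmxA DI mulmxA.
  - by exists (D *m u) => //; exists u.
have Dinj (v : 'cV_(d k)) : D *m v = 0 -> v = 0.
  move=> Dv; apply: contrapT => v0; apply: Du.
  apply: (irr_submodule (P := fun u => D *m u = 0)); last by exists v.
  - split; first by rewrite mulmx0.
    by move=> c x z Dx Dz; rewrite mulmxDr -scalemxAr Dx Dz scaler0 addr0.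
  - by move=> a x Dx; rewrite mulmxA DI -mulmxA Dx mulmx0.
have /choice [q qE] := Dsurj.
pose Q := \matrix_(i, j) q (delta_mx j 0) i 0.
have DQ : D *m Q = 1%:M.
  apply/matrixP => i j; have /matrixP/(_ i 0) := qE (delta_mx j 0).
  rewrite !mxE eqxx andbT => <-; apply: eq_bigr => r _; by rewrite !mxE.
have QD : Q *m D = 1%:M.
  apply/eqP; rewrite -subr_eq0; apply/eqP/matrixP => i j.
  have : D *m col j (Q *m D - 1%:M) = 0.
    by rewrite colE mulmxA mulmxBr mulmxA DQ mul1mx mulmx1 subrr mul0mx.
  by move=> /Dinj /matrixP /(_ i 0); rewrite !mxE.
exists D => //; apply/andP; split; [apply/row_freeP|apply/row_fullP]; by exists Q.
Qed.

Definition commutes_with l (D : 'M[F]_(d l)) : Prop :=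
  forall a, D *m f l a = f l a *m D.

(** Jacobson density for the direct sum of the modules [f k], with [U] in place of
    the span of the [l]-components of [ts] over the division algebra of
    endomorphisms.  It is proved by induction on [ts].  If [v] is killed by every
    [b] that kills [(k, u) :: ts], then [f k b *m u |-> f l b *m v] is a well
    defined intertwiner [D] on the orbit of [u] under the annihilator of [ts], and
    that orbit, if nonzero, is the whole module.  Thus [v - D *m u] is killed by the annihilator
    of [ts], and Schur's lemma takes care of [D *m u]. *)
Lemma density l (ts : seq {k & 'cV[F]_(d k)}) (v : 'cV[F]_(d l)) :
  (forall b, annihilates ts b -> f l b *m v = 0) ->
  forall U : {vspace 'cV[F]_(d l)},
  (forall D, commutes_with D -> forall u, u \in U -> D *m u \in U) ->
  (forall u, Tagged (fun k => 'cV[F]_(d k)) u \in ts -> u \in U) -> v \in U.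
Proof.
have [[one oneE] fD fM] := closedf.
elim: ts v => [|[k u] ts IH] v vts U stU tsU.
  by have := vts one; rewrite oneE mul1mx => -> //; exact: mem0v.
have tsU' x : Tagged (fun k => 'cV[F]_(d k)) x \in ts -> x \in U.
  by move=> xts; apply: tsU; rewrite inE xts orbT.
pose J := annihilates ts.
have [Ju|/existsNP[b0 /not_implyP[Jb0 b0u]]] :=
    pselect (forall b, J b -> f k b *m u = 0).
  apply: IH => // b Jb; apply: vts => t; rewrite inE => /orP[/eqP->|]; last exact: Jb.
  exact: Ju.
have Jideal : left_ideal J by exact: annihilates_left_ideal.
have [J0 JD JM] := Jideal.
have Jorb : forall w, exists b, J b /\ f k b *m u = w.
  move=> w; have [|b Jb bE] := left_ideal_orbit Jideal _ (u := u) w; last by exists b.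
  by exists b0.
have uv b : J b -> f k b *m u = 0 -> f l b *m v = 0.
  move=> Jb bu; apply: vts => t; rewrite inE => /orP[/eqP->//|]; exact: Jb.
have /choice [q qE] := Jorb.
(* The element [q w] of the annihilator carries [u] to [w]. *)
pose D : 'M[F]_(d l, d k) := \matrix_(i, j) (f l (q (delta_mx j 0)) *m v) i 0.
have DE (w : 'cV[F]_(d k)) : D *m w = f l (q w) *m v.
  have [a Ja [aw <-]] : exists2 a, J a & f k a *m u = w /\ f l a *m v = D *m w.
    have dec (x : 'cV[F]_(d k)) : x = \sum_j x j 0 *: delta_mx j 0.
      apply/matrixP => i j; rewrite summxE (bigD1 i) //= !mxE ord1 !eqxx mulr1 big1 ?addr0 //.
      by move=> r /negbTE ri; rewrite !mxE eq_sym ri mulr0.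
    have [a Ja [aw av]] : exists2 a, J a & f k a *m u = \sum_j w j 0 *: delta_mx j 0 /\
        f l a *m v = \sum_j w j 0 *: (f l (q (delta_mx j 0)) *m v).
      elim: (index_enum _) => [|j r [a Ja [aw av]]].
        have [a Ja a0] := J0; exists a => //.
        by rewrite !a0 !mul0mx !big_nil.
      have [Jq qu] := qE (delta_mx j 0).
      have [e Je eE] := JD (w j 0) _ _ Jq Ja; exists e => //.
      by rewrite !eE !mulmxDl -!scalemxAl qu aw av !big_cons.
    exists a => //; split; first by rewrite aw -dec.
    rewrite av.
    apply/matrixP => i j; rewrite summxE !mxE; apply: eq_bigr => r _.
    by rewrite ord1 !mxE mulrC.
  have [Jq qw] := qE w; have [e Je eE] := JD (-1) _ _ Jq Ja.
  have := uv e Je; rewrite !eE !mulmxDl -!scalemxAl !scaleN1r qw aw addNr => /(_ erefl) /eqP.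
  by rewrite addrC subr_eq0 => /eqP.
have DJ b : J b -> D *m (f k b *m u) = f l b *m v.
  move=> Jb; rewrite DE; have [Jq qw] := qE (f k b *m u); have [e Je eE] := JD (-1) _ _ Jq Jb.
  have := uv e Je; rewrite !eE !mulmxDl -!scalemxAl !scaleN1r qw addNr => /(_ erefl) /eqP.
  by rewrite addrC subr_eq0 => /eqP.
have DI a : D *m f k a = f l a *m D.
  apply/matrixP => i j.
  have [Jq qw] := qE (delta_mx j 0); have [e Je eE] := JM a _ Jq.
  have /matrixP/(_ i 0) : D *m f k a *m (delta_mx j 0 : 'cV_(d k)) = f l a *m D *m delta_mx j 0.
    by rewrite -!mulmxA [D *m delta_mx j 0]DE -[in LHS]qw (mulmxA (f k a)) -eE DJ // eE -mulmxA.
  by rewrite -!colE !mxE.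
have vDu : v - D *m u \in U.
  by apply: IH => // b Jb; rewrite mulmxBr mulmxA -DI -mulmxA DJ ?subrr.
suff Du : D *m u \in U by rewrite -[v](subrK (D *m u)) memvD.
have [D0|/intertwiner_cases kl] := pselect (D = 0); first by rewrite D0 mul0mx mem0v.
have := kl DI => {kl} kl; subst k.
by apply: stU => //; apply: tsU; rewrite inE eqxx.
Qed.

(** Among the elements that act by zero on every [f k] with [k != l], take one
    whose fixed space on [f l] is largest.  That space is stable under the
    endomorphisms of the module, so if a vector [v] is missing, density gives an
    element that kills the fixed space and the other modules, and sends [v] to the
    defect [v - f l a *m v].  Adding it would enlarge the fixed space. *)
Lemma isolating_element l :
  exists2 a, f l a = 1%:M & forall k, k != l -> f k a = 0.
Proof.
have [[one oneE] fD fM] := closedf.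
pose fixes a (U : {vspace 'cV[F]_(d l)}) := forall u, u \in U -> f l a *m u = u.
pose D (n : nat) := `[< exists a, (forall k, k != l -> f k a = 0) /\
  exists2 U, \dim U = n & fixes a U >].
have exD : exists n, D n.
  have [e eE] := fD (-1) one one.
  exists 0%N; apply/asboolP; exists e; split=> [k _|]; first by rewrite eE scaleN1r addNr.
  by exists 0%VS; rewrite ?dimv0 // => u; rewrite memv0 => /eqP->; rewrite mulmx0.
have bD n : D n -> (n <= \dim (fullv : {vspace 'cV[F]_(d l)}))%N.
  by move=> /asboolP[a [_ [U <- _]]]; apply: dimvS; exact: subvf.
have [n /asboolP[a [a0 [U dU aU]]] nmax] := ex_maxnP exD bD.
have [U' U'P] : exists U' : {vspace 'cV[F]_(d l)}, forall v, v \in U' <-> f l a *m v = v.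
  apply: subspace_pred_vspace; split; first by rewrite mulmx0.
  by move=> c u v au av; rewrite mulmxDr -scalemxAr au av.
have dU' : (n <= \dim U')%N by rewrite -dU; apply: dimvS; apply/subvP => u /aU /U'P.
exists a => //; apply/eqP; rewrite -subr_eq0; apply/eqP/matrixP => i j.
suff aT (v : 'cV_(d l)) : f l a *m v = v.
  have /matrixP/(_ i 0) : (f l a - 1%:M) *m (delta_mx j 0 : 'cV_(d l)) = 0.
    by rewrite mulmxBl mul1mx aT subrr.
  by rewrite -colE !mxE.
apply/U'P; apply: contraT => nvU.
pose ts : seq {k & 'cV[F]_(d k)} :=
  [seq t <- [seq Tagged (fun k => 'cV[F]_(d k)) (delta_mx (tagged p) 0) |
     p : {k & 'I_(d k)}] | tag t != l] ++
  [seq Tagged (fun k => 'cV[F]_(d k)) u | u <- vbasis U'].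
pose J := annihilates ts.
have [b0 /not_implyP[Jb0 b0v]] :
    exists b, ~ (J b -> f l b *m v = 0).
  apply/existsNP => Jv; case/negP: nvU; apply: (density Jv).
    move=> X XC u /U'P au; apply/U'P.
    by rewrite mulmxA -XC -mulmxA au.
  move=> u; rewrite mem_cat mem_filter eqxx /= => /mapP[w wU /eqP].
  by rewrite eq_Tagged => /eqP /= ->; exact: vbasis_mem.
have [b Jb bv] : exists2 b, J b & f l b *m v = v - f l a *m v.
  by apply: (left_ideal_orbit (annihilates_left_ideal ts) (u := v)); exists b0.
have [e eE] := fD 1 a b.
suff : D (\dim U').+1 by move=> /nmax; rewrite leqNgt ltnS dU'.
apply/asboolP; exists e; split.
  move=> k kl; rewrite eE scale1r a0 // add0r; apply/matrixP => i' j'.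
  have /matrixP/(_ i' 0) : f k b *m delta_mx j' 0 = 0 :> 'cV_(d k).
    apply: (Jb (Tagged (fun k => 'cV[F]_(d k)) (delta_mx j' 0))).
    rewrite mem_cat mem_filter kl /=; apply/orP; left.
    by apply/mapP; exists (Tagged (fun k => 'I_(d k)) j') => //; rewrite mem_enum.
  by rewrite -colE !mxE.
exists (U' + <[v]>)%VS.
  exact: dimv_add_line.
have bU u : u \in U' -> f l b *m u = 0.
  move=> uU; rewrite (coord_vbasis uU) mulmx_sumr big1 // => r _.
  rewrite -scalemxAr (Jb (Tagged (fun k => 'cV[F]_(d k)) (vbasis U')`_r)) ?scaler0 //.
  rewrite mem_cat; apply/orP; right; apply: map_f; apply: mem_nth.
  by rewrite size_tuple.
move=> w /memv_addP[u uU [_ /vlineP[c ->] ->]].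
rewrite eE scale1r mulmxDl !mulmxDr -!scalemxAr bU // bv (U'P u).1 // add0r.
by rewrite -addrA -scalerDr [f l a *m v + _]addrC subrK.
Qed.

(** Evaluating the relation at an element isolating [l] leaves [c l] times the
    dimension of the module, which is where the characteristic matters. *)
Lemma trace_independence (c : L -> F) :
  (forall n : nat, n.+1%:R != 0 :> F) ->
  (forall a, \sum_l c l * \tr (f l a) = 0) -> forall l, c l = 0.
Proof.
move=> char0 ctr l; have [a al ak] := isolating_element l.
have := ctr a; rewrite (bigD1 l) //= big1 => [|k kl]; last by rewrite ak // mxtrace0 mulr0.
rewrite al addr0 mxtrace1 => /eqP; rewrite mulf_eq0 => /orP[/eqP//|].
by have [dl _] := irrf l; rewrite -(prednK dl) (negbTE (char0 _)).
Qed.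
End TraceIndependence.

(** * Twisting Hecke algebras by characters of the braid group *)

Section GroupAlgebraTwist.
Context (S S' : comNzRingType) (G : groupType).
Context (phi : {rmorphism S -> S'}) (c : G -> S').

Lemma ga_twist_subproof (f : group_algebra S G) :
  finitely_supported (fun g : G => phi (ga_coef f g) * c g : S'^o).
Proof.
apply/asboolP; apply: (@sub_finite_set _ _ [set g | ga_coef f g != 0]%classic).
  by move=> g /=; apply: contraNneq => ->; rewrite rmorph0 mul0r.
by have /asboolP := valP f.
Qed.

Definition ga_twist (f : group_algebra S G) : group_algebra S' G :=
  exist (fun u : G -> S'^o => finitely_supported u) _ (ga_twist_subproof f).

Lemma ga_coef_twist f g : ga_coef (ga_twist f) g = phi (ga_coef f g) * c g.
Proof. by []. Qed.

Lemma ga_twistD f h : ga_twist (f + h) = ga_twist f + ga_twist h.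
Proof. by apply/ga_eqP => g; rewrite ga_coefD !ga_coef_twist ga_coefD rmorphD mulrDl. Qed.

Lemma ga_twistZ a f : ga_twist (a *: f) = phi a *: ga_twist f.
Proof. by apply/ga_eqP => g; rewrite ga_coefZ !ga_coef_twist ga_coefZ rmorphM mulrA. Qed.

Lemma ga_twist_sum (I : Type) (r : seq I) (F : I -> group_algebra S G) :
  ga_twist (\sum_(i <- r) F i) = \sum_(i <- r) ga_twist (F i).
Proof.
elim: r => [|i r IH]; last by rewrite !big_cons ga_twistD IH.
by rewrite !big_nil; apply/ga_eqP => g; rewrite ga_coef_twist !ga_coef0 rmorph0 mul0r.
Qed.

Lemma ga_twist_single g : ga_twist (ga_single S g) = c g *: ga_single S' g.
Proof.
apply/ga_eqP => h; rewrite ga_coefZ ga_coef_twist !ga_coef_single rmorph_nat.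
by have [->|_] := eqVneq h g; rewrite ?mulr1 ?mul1r // mulr0 mul0r.
Qed.

Hypothesis c1 : c 1%g = 1.
Hypothesis cM : forall g h, c (g * h)%g = c g * c h.

Lemma ga_twist1 : ga_twist 1 = 1.
Proof. by rewrite [LHS]ga_twist_single c1 scale1r. Qed.

Lemma ga_twistM f h : ga_twist (f * h) = ga_twist f * ga_twist h.
Proof.
rewrite [f](@ga_expand _ _ f (ga_supp f)) ?ga_supp_uniq //.
rewrite [h](@ga_expand _ _ h (ga_supp h)) ?ga_supp_uniq //.
rewrite mulr_suml !ga_twist_sum mulr_suml; apply: eq_bigr => a _.
rewrite mulr_sumr !ga_twist_sum mulr_sumr; apply: eq_bigr => b _.
rewrite !ga_twistZ -!scalerAl -!scalerAr !ga_twistZ -ga_singleM !ga_twist_single cM.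
by rewrite -!scalerAl -!scalerAr !scalerA ga_singleM -!mulrA.
Qed.

Lemma ga_twist_prod (I : Type) (r : seq I) (F : I -> group_algebra S G) :
  ga_twist (\prod_(i <- r) F i) = \prod_(i <- r) ga_twist (F i).
Proof.
by elim: r => [|i r IH]; rewrite ?big_nil ?ga_twist1 // !big_cons ga_twistM IH.
Qed.
End GroupAlgebraTwist.

Lemma quotient_mapB (S : comNzRingType) (A : algType S) (X : set A) (a b : A) :
  quotient_map X (a - b) = quotient_map X a - quotient_map X b.
Proof. by rewrite -(scaleN1r b) quotient_mapD quotient_mapZ scaleN1r. Qed.

Section HeckeTwist.
Context (R : realType) (K : splittingFieldType rat) (iota : {rmorphism K -> R[i]}).
Context (n : nat) (W : finGroupType) (rW : mx_representation K [set: W]%G n).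
Context (x0 : Vreg iota rW).
Local Notation B := (braid_group x0).

Section Hecke.
Context (S : comNzRingType) (u : parameter rW -> S).
Local Notation H := (hecke x0 u).

Lemma hecke_gen1 : hecke_gen u (1%g : B) = 1.
Proof. by []. Qed.

Lemma hecke_genM (a b : B) : hecke_gen u (a * b)%g = hecke_gen u a * hecke_gen u b.
Proof. by rewrite /hecke_gen ga_singleM quotient_mapM. Qed.

Lemma hecke_ind (P : H -> Prop) : P 0 ->
  (forall c x y, P x -> P y -> P (c *: x + y)) ->
  (forall b, P (hecke_gen u b)) -> forall h, P h.
Proof.
move=> P0 PD Pg; elim/quotient_map_surj => f.
rewrite [f](@ga_expand _ _ f (ga_supp f)) ?ga_supp_uniq //.
elim: (ga_supp f) => [|b r IH]; first by rewrite big_nil.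
by rewrite big_cons quotient_mapD quotient_mapZ; apply: PD => //; exact: Pg.
Qed.

Lemma hecke_relation_gen O (s : B) : monodromy_generator O s ->
  \prod_(j < orbit_order O) (hecke_gen u s - u (Tagged _ j) *: (1 : H)) = 0.
Proof.
move=> sO; transitivity (quotient_map (@hecke_relation _ _ _ _ _ _ x0 _ u)
  (\prod_(j < orbit_order O) (ga_single S s - (u (Tagged _ j))%:A))).
  elim: (index_enum _) => [|j r IH]; first by rewrite !big_nil.
  rewrite !big_cons quotient_mapM -IH; congr (_ * _).
  by rewrite quotient_mapB quotient_mapZ.
by apply/quotient_map_eq0 => J iJ; apply; exists O, s.
Qed.
End Hecke.

Section Twist.
Context (S S' : comNzRingType) (u : parameter rW -> S) (u' : parameter rW -> S').
Context (phi : {rmorphism S -> S'}) (c : B -> S').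

(** The map [f * T_b |-> phi f * c b * T_b].  Both the automorphism of the generic
    algebra used for homogeneity and the isomorphism between two cyclotomic
    algebras have this form. *)
Definition hecke_twist (h : hecke x0 u) : hecke x0 u' :=
  quotient_map _ (ga_twist phi c (repr h)).

Hypothesis c1 : c 1%g = 1.
Hypothesis cM : forall g h, c (g * h)%g = c g * c h.
Hypothesis cu : forall O (s : B) (j : 'I_(orbit_order O)), monodromy_generator O s ->
  phi (u (Tagged _ j)) = c s * u' (Tagged _ j).

(** By [cu] the twist multiplies each factor [s - u_j] of a relation by the scalar
    [c s], so it sends relations to multiples of relations. *)
Lemma hecke_twist_map f : hecke_twist (quotient_map _ f) = quotient_map _ (ga_twist phi c f).
Proof.
suff ideal a : ideal_generated (@hecke_relation _ _ _ _ _ _ x0 _ u) a ->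
    ideal_generated (@hecke_relation _ _ _ _ _ _ x0 _ u') (ga_twist phi c a).
  have /ideal : ideal_generated (@hecke_relation _ _ _ _ _ _ x0 _ u)
      (repr (quotient_map (@hecke_relation _ _ _ _ _ _ x0 _ u) f) - f).
    by apply/quotient_mapP; rewrite /quotient_map reprK.
  by rewrite -scaleN1r ga_twistD ga_twistZ rmorphN1 scaleN1r => /quotient_mapP.
have [J0 JD JM] := ideal_generatedP (@hecke_relation _ _ _ _ _ _ x0 _ u').
pose J x := ideal_generated (@hecke_relation _ _ _ _ _ _ x0 _ u') (ga_twist phi c x).
move=> Ja; apply: (Ja J); first split.
- rewrite /J (_ : ga_twist _ _ _ = 0) //.
  by apply/ga_eqP => g; rewrite ga_coef_twist !ga_coef0 rmorph0 mul0r.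
- by move=> x y Jx Jy; rewrite /J ga_twistD; exact: JD.
- by move=> x y z Jy; rewrite /J !ga_twistM //; exact: JM.
move=> _ [ O [s [sO ->]]]; rewrite /J ga_twist_prod //.
have -> : \prod_(j < orbit_order O) ga_twist phi c (ga_single S s - (u (Tagged _ j))%:A) =
    (\prod_(j < orbit_order O) c s) *:
      \prod_(j < orbit_order O) (ga_single S' s - (u' (Tagged _ j))%:A).
  rewrite -scaler_prod; apply: eq_bigr => j _.
  rewrite -scaleNr ga_twistD ga_twistZ ga_twist_single ga_twist1 // rmorphN.
  by rewrite (cu _ sO) scalerBr scalerA scaleNr.
set k := \prod_(j < _) c s; set r := \prod_(j < _) _; have -> : k *: r = k%:A * r * 1.
  by rewrite mulr1 -scalerAl mul1r.
by apply: JM => J' iJ'; apply; exists O, s.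
Qed.

Lemma hecke_twist_semilinear a x y :
  hecke_twist (a *: x + y) = phi a *: hecke_twist x + hecke_twist y.
Proof.
elim/quotient_map_surj : x => x; elim/quotient_map_surj : y => y.
by rewrite -quotient_mapZ -quotient_mapD !hecke_twist_map ga_twistD ga_twistZ
  quotient_mapD quotient_mapZ.
Qed.

Lemma hecke_twistM x y : hecke_twist (x * y) = hecke_twist x * hecke_twist y.
Proof.
elim/quotient_map_surj : x => x; elim/quotient_map_surj : y => y.
by rewrite -quotient_mapM !hecke_twist_map ga_twistM // quotient_mapM.
Qed.

Lemma hecke_twist_gen b : hecke_twist (hecke_gen u b) = c b *: hecke_gen u' b.
Proof. by rewrite hecke_twist_map ga_twist_single quotient_mapZ. Qed.

Lemma hecke_twist1 : hecke_twist 1 = 1.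
Proof. by rewrite -hecke_gen1 hecke_twist_gen c1 scale1r. Qed.
End Twist.

Lemma hecke_twistK (S S' : comNzRingType) (u : parameter rW -> S) (u' : parameter rW -> S')
  (phi : {rmorphism S -> S'}) (psi : {rmorphism S' -> S}) (c : B -> S') (c' : B -> S)
  (c1 : c 1%g = 1) (cM : forall g h, c (g * h)%g = c g * c h)
  (cu : forall O (s : B) (j : 'I_(orbit_order O)), monodromy_generator O s ->
    phi (u (Tagged _ j)) = c s * u' (Tagged _ j))
  (c'1 : c' 1%g = 1) (c'M : forall g h, c' (g * h)%g = c' g * c' h)
  (c'u : forall O (s : B) (j : 'I_(orbit_order O)), monodromy_generator O s ->
    psi (u' (Tagged _ j)) = c' s * u (Tagged _ j)) :
  cancel phi psi -> (forall b, psi (c b) * c' b = 1) ->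
  cancel (hecke_twist (u := u) u' phi c) (hecke_twist u psi c').
Proof.
move=> phiK cK; elim/quotient_map_surj => f.
rewrite !hecke_twist_map //; congr quotient_map; apply/ga_eqP => g.
by rewrite !ga_coef_twist rmorphM phiK -mulrA cK mulr1.
Qed.
End HeckeTwist.

(** * Homogeneity of the canonical symmetrizing form *)

Section GroupAlgebraAutomorphism.
Context (S : comNzRingType) (G : groupType) (alpha beta : G -> G).
Hypotheses (alphaK : cancel alpha beta) (betaK : cancel beta alpha).

Lemma ga_reindex_subproof (f : group_algebra S G) :
  finitely_supported (fun g : G => ga_coef f (beta g)).
Proof.
apply/asboolP.
apply: (@sub_finite_set _ _ (alpha @` [set g | ga_coef f g != 0])%classic).
  by move=> g /= fg; exists (beta g).
by apply: finite_image; have /asboolP := valP f.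
Qed.

Definition ga_reindex (f : group_algebra S G) : group_algebra S G :=
  exist (fun u : G -> S^o => finitely_supported u) _ (ga_reindex_subproof f).

Lemma ga_coef_reindex f g : ga_coef (ga_reindex f) g = ga_coef f (beta g).
Proof. by []. Qed.

Lemma ga_reindex_single a : ga_reindex (ga_single S a) = ga_single S (alpha a).
Proof.
apply/ga_eqP => g; rewrite ga_coef_reindex !ga_coef_single; congr (nat_of_bool _)%:R.
by apply/eqP/eqP => [<-|->].
Qed.

Lemma ga_reindex_sum (r : seq G) (F : G -> group_algebra S G) :
  ga_reindex (\sum_(i <- r) F i) = \sum_(i <- r) ga_reindex (F i).
Proof. by apply/ga_eqP => g; rewrite ga_coef_reindex !ga_coef_sum. Qed.

(** The inverse [beta] of [alpha] appears because moving the basis along [alpha]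
    moves coefficients along [beta]. *)
Lemma ga_automorphism : (forall a b, alpha (a * b)%g = (alpha a * alpha b)%g) ->
  exists sigma : {rmorphism group_algebra S G -> group_algebra S G},
    forall f g, ga_coef (sigma f) g = ga_coef f (beta g).
Proof.
move=> alphaM.
have alpha1 : alpha 1%g = 1%g.
  by apply: (mulgI (alpha 1%g)); rewrite -alphaM !mulg1.
have rB : zmod_morphism ga_reindex by move=> f h; exact/ga_eqP.
have rM : monoid_morphism ga_reindex.
  split; first by rewrite [LHS]ga_reindex_single alpha1.
  move=> f h.
  rewrite [f](@ga_expand _ _ f (ga_supp f)) ?ga_supp_uniq //.
  rewrite [h](@ga_expand _ _ h (ga_supp h)) ?ga_supp_uniq //.
  have rZ c k : ga_reindex (c *: k) = c *: ga_reindex k by exact/ga_eqP.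
  rewrite mulr_suml !ga_reindex_sum mulr_suml; apply: eq_bigr => a _.
  rewrite mulr_sumr !ga_reindex_sum mulr_sumr; apply: eq_bigr => b _.
  rewrite -!scalerAl -!scalerAr !rZ -ga_singleM !ga_reindex_single alphaM ga_singleM.
  by rewrite -!scalerAl -!scalerAr.
pose aB := GRing.isZmodMorphism.Build _ _ ga_reindex rB.
pose aM := GRing.isMonoidMorphism.Build _ _ ga_reindex rM.
by exists (HB.pack_for {rmorphism group_algebra S G -> group_algebra S G} ga_reindex aB aM).
Qed.
End GroupAlgebraAutomorphism.

Section LaurentAutomorphism.
Context (I : finType) (N : I -> int) (k0 : exponents I).
Local Notation E := (exponents I).

Definition weighted_degree (k : E) : int := \sum_i N i * k i.

Lemma exponentE (k l : E) i : (k * l)%g i = k i + l i.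
Proof. by rewrite [LHS]ffunE. Qed.

Lemma exponentV (k : E) i : (k^-1)%g i = - k i.
Proof. by rewrite [LHS]ffunE. Qed.

Lemma exponent1 i : (1%g : E) i = 0.
Proof. by rewrite [LHS]ffunE. Qed.

Lemma weighted_degreeM (k l : E) :
  weighted_degree (k * l)%g = weighted_degree k + weighted_degree l.
Proof. by rewrite -big_split; apply: eq_bigr => i _; rewrite exponentE mulrDr. Qed.

Definition exponent_scale (c : int) : E := [ffun i => c * k0 i].

Lemma exponent_scaleD c d :
  exponent_scale (c + d) = (exponent_scale c * exponent_scale d)%g.
Proof. by apply/ffunP => i; rewrite exponentE !ffunE mulrDl. Qed.

(** On monomials this is [u^k |-> u^k x^(c deg k)] with [x = u^k0].  Since [x] has
    degree 0 the degree is preserved, which makes the map invertible. *)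
Definition shear (c : int) (k : E) : E := (k * exponent_scale (c * weighted_degree k))%g.

Hypothesis deg0 : weighted_degree k0 = 0.

Lemma weighted_degree_scale c : weighted_degree (exponent_scale c) = 0.
Proof.
rewrite -[RHS](mulr0 c) -deg0 mulr_sumr; apply: eq_bigr => i _.
by rewrite ffunE mulrCA.
Qed.

Lemma weighted_degree_shear c k : weighted_degree (shear c k) = weighted_degree k.
Proof. by rewrite weighted_degreeM weighted_degree_scale addr0. Qed.

Lemma shearK c : cancel (shear c) (shear (- c)).
Proof.
move=> k; rewrite /shear -/(shear c k) weighted_degree_shear -mulgA -exponent_scaleD.
by rewrite mulNr subrr; apply/ffunP => i; rewrite exponentE ffunE mul0r addr0.
Qed.

Lemma shearM c k l : shear c (k * l)%g = (shear c k * shear c l)%g.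
Proof.
by apply/ffunP => i; rewrite !exponentE !ffunE weighted_degreeM mulrDr mulrDl addrACA.
Qed.
End LaurentAutomorphism.

Section Monomials.
Context (I : finType).
Local Notation E := (exponents I).

Definition monomial_eval (F : fieldType) (x : I -> F) (k : E) : F := \prod_i x i ^ k i.

Lemma monomial_evalM (F : fieldType) (x : I -> F) (k l : E) : (forall i, x i != 0) ->
  monomial_eval x (k * l)%g = monomial_eval x k * monomial_eval x l.
Proof.
move=> x0; rewrite -big_split; apply: eq_bigr => i _.
by rewrite exponentE expfzDr.
Qed.

Definition exponent_delta (i : I) (c : int) : E := [ffun l => c * (l == i)%:R].

Lemma weighted_degree_delta N i c : weighted_degree N (exponent_delta i c) = N i * c.
Proof.
rewrite /weighted_degree (bigD1 i) //= ffunE eqxx mulr1 big1 ?addr0 //.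
by move=> l /negbTE li; rewrite ffunE li !mulr0.
Qed.

Lemma monomial_eval_delta (F : fieldType) (x : I -> F) i c :
  monomial_eval x (exponent_delta i c) = x i ^ c.
Proof.
rewrite /monomial_eval (bigD1 i) //= ffunE eqxx mulr1 big1 ?mulr1 //.
by move=> l /negbTE li; rewrite ffunE li mulr0 expr0z.
Qed.

(** Powers of the quotient of two variables of equal degree provide the monomial of
    degree 0 used in the proof of homogeneity. *)
Lemma exponent_delta_difference (N : I -> int) (i j : I) (c : int) :
  N i = N j -> weighted_degree N (exponent_delta i c * exponent_delta j (- c))%g = 0.
Proof. by move=> Nij; rewrite weighted_degreeM !weighted_degree_delta Nij mulrN subrr. Qed.

Lemma monomial_eval_difference (F : fieldType) (x : I -> F) (i j : I) (c : int) :
  (forall i, x i != 0) ->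
  monomial_eval x (exponent_delta i c * exponent_delta j (- c))%g = x i ^ c * x j ^ (- c).
Proof. by move=> x0; rewrite monomial_evalM // !monomial_eval_delta. Qed.

Lemma exponent_difference_neq1 (i j : I) (c : int) : i != j -> c != 0 ->
  (exponent_delta i c * exponent_delta j (- c))%g != 1%g :> E.
Proof.
move=> /negbTE ij c0; apply/eqP => /ffunP/(_ i).
rewrite exponentE exponent1 !ffunE eqxx ij mulr0 addr0 mulr1 => /eqP.
by rewrite (negbTE c0).
Qed.
End Monomials.

Section LaurentCoefficients.
Context (I : finType) (S : comNzRingType).
Local Notation E := (exponents I).

Lemma ga_coef_inv (f : laurent S I) (k : E) : ga_coef (laurent_inv f) k = ga_coef f (k^-1)%g.
Proof.
rewrite /laurent_inv ga_coef_sum.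
rewrite [in RHS](@ga_expand _ _ f (ga_supp f)) ?ga_supp_uniq //.
rewrite ga_coef_sum; apply: eq_bigr => l _; rewrite !ga_coefZ !ga_coef_single.
by congr (_ * (nat_of_bool _)%:R); apply/eqP/eqP => [->|<-]; rewrite invgK.
Qed.
End LaurentCoefficients.

Section Homogeneity.
Context (R : realType) (K : splittingFieldType rat) (iota : {rmorphism K -> R[i]}).
Context (n : nat) (W : finGroupType) (rW : mx_representation K [set: W]%G n).
Local Notation E := (exponents (parameter rW)).
Local Notation G := (generic_ring rW).

Lemma laurent_eval_reindex (F : fieldType) (x : parameter rW -> F) (f f' : G)
    (alpha beta : E -> E) :
  cancel alpha beta -> cancel beta alpha ->
  (forall k, ga_coef f' k = ga_coef f (beta k)) ->
  (forall k, monomial_eval x (alpha k) = monomial_eval x k) ->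
  laurent_eval x f' = laurent_eval x f.
Proof.
move=> aK bK ff' xa; rewrite /laurent_eval.
rewrite (perm_big (map alpha (ga_supp f))); last first.
  apply: uniq_perm; rewrite ?map_inj_uniq ?ga_supp_uniq //; first exact: can_inj aK.
  move=> k; rewrite mem_ga_supp ff' -mem_ga_supp.
  by apply/idP/mapP => [kf|[l lf ->]]; [exists (beta k)|rewrite aK].
rewrite big_map; apply: eq_bigr => k _; rewrite ff' aK; congr (_ * _).
exact: xa.
Qed.

Context (x0 : Vreg iota rW).
Local Notation B := (braid_group x0).
Local Notation T b := (hecke_gen (@laurent_var int (parameter rW) : _ -> G) (b : B)).
Context (zeta : hyperplane_orbit rW -> K) (zeta0 : forall O, zeta O != 0).
Context (t : {scalar generic_hecke x0}) (tP : canonical_symmetrizing_form zeta t).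
Hypothesis t_unique : forall t', canonical_symmetrizing_form zeta t' -> forall h, t' h = t h.
Context (N : parameter rW -> int) (k0 : E) (ell : B -> int).
Hypothesis deg0 : weighted_degree N k0 = 0.
Hypothesis zeta_k0 : monomial_eval (fun i : parameter rW => zeta (tag i) ^+ tagged i) k0 = 1.
Hypothesis ellM : forall a b, ell (a * b)%g = ell a + ell b.
Hypothesis ell_monodromy : forall O (s : B) (j : 'I_(orbit_order O)),
  monodromy_generator O s -> ell s = N (Tagged _ j).

Let spec_x (i : parameter rW) := zeta (tag i) ^+ tagged i.
Let spec_x0 i : spec_x i != 0. Proof. by rewrite expf_neq0. Qed.

Let ell1 : ell 1%g = 0.
Proof. by apply: (addrI (ell 1%g)); rewrite -ellM mulg1 addr0. Qed.

Let ellV b : ell b^-1%g = - ell b.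
Proof. by apply/eqP; rewrite -addr_eq0 -ellM mulVg ell1. Qed.

Let X (c : int) : G := ga_single int (exponent_scale k0 c).

Let XD c d : X (c + d) = X c * X d.
Proof. by rewrite /X exponent_scaleD ga_singleM. Qed.

Let X0 : X 0 = 1.
Proof. by congr ga_single; apply/ffunP => i; rewrite !ffunE mul0r. Qed.

Let coefX c (f : G) k : ga_coef (X c * f) k = ga_coef f (exponent_scale k0 (- c) * k)%g.
Proof.
rewrite [X c * f]ga_mul_single ga_coef_translate; congr (ga_coef f (_ * k)%g).
by apply/ffunP => i; rewrite exponentV !ffunE mulNr.
Qed.

Let monomial_scale c : monomial_eval spec_x (exponent_scale k0 c) = 1.
Proof.
transitivity (monomial_eval spec_x k0 ^ c); last by rewrite zeta_k0 exp1rz.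
rewrite /monomial_eval (big_morph (fun z => z ^ c) (id1 := 1) (op1 := *%R)).
- by apply: eq_bigr => i _; rewrite ffunE mulrC exprz_exp.
- by move=> a b; exact: expfzMl.
- exact: exp1rz.
Qed.

(** The shears of exponents extend to the Laurent polynomial ring as automorphisms:
    multiplication of the elements of degree [k] by [X (c * k)]. *)
Let sigma_ex (c : int) : exists sigma : {rmorphism G -> G},
  forall f k, ga_coef (sigma f) k = ga_coef f (shear N k0 (- c) k).
Proof.
have cK : cancel (shear N k0 c) (shear N k0 (- c)) := shearK deg0 c.
have Kc : cancel (shear N k0 (- c)) (shear N k0 c).
  by rewrite -{2}(opprK c); exact: shearK deg0 (- c).
by apply: (ga_automorphism int cK Kc); exact: shearM.
Qed.

(** The form [sg^-1 \o t \o tau] is canonical: [X] specializes to 1, and the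
    conditions that involve [laurent_inv] are preserved because [laurent_inv]
    inverts [X] and commutes with [sg].  By uniqueness it equals [t], so the
    support of [t (T b)] is stable under [k |-> k + (deg k - ell b) k0].  This
    translation preserves the degree, and the support is finite. *)
Lemma canonical_form_homogeneous : k0 != 1%g ->
  forall b k, ga_coef (t (T b)) k != 0 -> weighted_degree N k = ell b.
Proof.
have [sg sgE] := sigma_ex 1; have [sg' sg'E] := sigma_ex (- 1).
have K1 : cancel (shear N k0 1) (shear N k0 (- 1)) := shearK deg0 1.
have K2 : cancel (shear N k0 (- 1)) (shear N k0 1) := shearK deg0 (- 1).
have sgK : cancel sg sg'.
  by move=> f; apply/ga_eqP => g; rewrite sg'E sgE opprK K1.
have sg'K : cancel sg' sg.
  by move=> f; apply/ga_eqP => g; rewrite sgE sg'E opprK K2.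
have shear_scale c d : shear N k0 c (exponent_scale k0 d) = exponent_scale k0 d.
  by rewrite /shear weighted_degree_scale // mulr0; apply/ffunP => i;
    rewrite exponentE !ffunE mul0r addr0.
have sgX c : sg (X c) = X c.
  apply/ga_eqP => g; rewrite sgE !ga_coef_single; congr (nat_of_bool _)%:R.
  by apply/eqP/eqP => [gE|->]; rewrite ?shear_scale // -(K2 g) gE shear_scale.
have sg'X c : sg' (X c) = X c by rewrite -{1}sgX sgK.
pose cx b := X (ell b); pose cx' b := X (- ell b).
have cx1 : cx 1%g = 1 by rewrite /cx ell1 X0.
have cx'1 : cx' 1%g = 1 by rewrite /cx' ell1 oppr0 X0.
have cxM g h : cx (g * h)%g = cx g * cx h by rewrite /cx ellM XD.
have cx'M g h : cx' (g * h)%g = cx' g * cx' h by rewrite /cx' ellM opprD XD.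
pose u := @laurent_var int (parameter rW) : _ -> G.
have deg_var i : weighted_degree N ([ffun l => (l == i)%:R] : E) = N i.
  rewrite -[RHS]mulr1 -weighted_degree_delta; congr weighted_degree.
  by apply/ffunP => l; rewrite !ffunE mul1r.
have cu O (s : B) (j : 'I_(orbit_order O)) : monodromy_generator O s ->
    sg (u (Tagged _ j)) = cx s * u (Tagged _ j).
  move=> sO; apply/ga_eqP => g; rewrite sgE coefX !ga_coef_single.
  congr (nat_of_bool _)%:R; rewrite (ell_monodromy j sO) -deg_var.
  set d := [ffun l => _] : E.
  (* Both equations say that [g] is the image of [d] under the shear. *)
  apply/eqP/eqP => gd; last first.
    have -> : g = shear N k0 1 d.
      apply/ffunP => i; move/ffunP/(_ i): gd; rewrite !exponentE !ffunE => <-.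
      by rewrite mul1r mulNr addrAC addNr add0r.
    by rewrite K1.
  rewrite -(K2 g) gd; apply/ffunP => i; rewrite !exponentE !ffunE.
  by rewrite mul1r mulNr addrC addrK.
have c'u O (s : B) (j : 'I_(orbit_order O)) : monodromy_generator O s ->
    sg' (u (Tagged _ j)) = cx' s * u (Tagged _ j).
  by move=> sO; rewrite -[RHS]sgK rmorphM (cu _ _ j sO) sgX mulrA -XD addNr X0 mul1r.
have XK c : X c * X (- c) = 1 by rewrite -XD subrr X0.
pose tau : generic_hecke x0 -> generic_hecke x0 := hecke_twist u sg cx.
pose tau' : generic_hecke x0 -> generic_hecke x0 := hecke_twist u sg' cx'.
have tauK : cancel tau tau'.
  by apply: hecke_twistK => // a; rewrite sg'X XK.
have tau'K : cancel tau' tau.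
  by apply: hecke_twistK => // a; rewrite sgX mulrC XK.
have tauM h h' : tau (h * h') = tau h * tau h' by apply: hecke_twistM.
have tauL a h h' : tau (a *: h + h') = sg a *: tau h + tau h' by apply: hecke_twist_semilinear.
have tau'L a h h' : tau' (a *: h + h') = sg' a *: tau' h + tau' h' by apply: hecke_twist_semilinear.
have tau_gen a : tau (T a) = X (ell a) *: T a by apply: hecke_twist_gen.
pose tf h := sg' (t (tau h)).
have tfL : linear_for *%R tf.
  by move=> a h h'; rewrite /tf tauL linearP rmorphD rmorphM sgK.
pose t' : {scalar generic_hecke x0} := HB.pack_for {scalar generic_hecke x0} tf
  (GRing.isLinear.Build _ _ _ _ tf tfL).
have t'E h : t' h = sg' (t (tau h)) by [].
have t'gen a : t' (T a) = sg' (X (ell a) * t (T a)) by rewrite t'E tau_gen linearZ.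
have sg'_spec f : specialize_group zeta (sg' f) = specialize_group zeta f.
  apply: (laurent_eval_reindex K2 K1) => k; first by rewrite sg'E opprK.
  by rewrite monomial_evalM // monomial_scale mulr1.
have X_spec c f : specialize_group zeta (X c * f) = specialize_group zeta f.
  apply: (@laurent_eval_reindex _ _ _ _ (fun k => exponent_scale k0 c * k)%g
    (fun k => exponent_scale k0 (- c) * k)%g) => k.
  - by rewrite mulgA -exponent_scaleD addNr; apply/ffunP => i; rewrite exponentE ffunE mul0r add0r.
  - by rewrite mulgA -exponent_scaleD subrr; apply/ffunP => i; rewrite exponentE ffunE mul0r add0r.
  - exact: coefX.
  - by rewrite monomial_evalM // monomial_scale mul1r.
have inv_sg' f : laurent_inv (sg' f) = sg' (laurent_inv f).
  apply/ga_eqP => k; rewrite ga_coef_inv !sg'E ga_coef_inv; congr ga_coef.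
  apply/ffunP => i; rewrite exponentV !exponentE exponentV !ffunE opprD.
  congr (_ + _); rewrite -mulNr -mulrN; congr (_ * _ * _).
  by rewrite /weighted_degree -sumrN; apply: eq_bigr => r _; rewrite exponentV mulrN.
have inv_X c f : laurent_inv (X c * f) = X (- c) * laurent_inv f.
  apply/ga_eqP => k; rewrite ga_coef_inv !coefX ga_coef_inv opprK; congr ga_coef.
  by apply/ffunP => i; rewrite !(exponentE, exponentV) !ffunE opprD mulNr.
have [[tC tND] tspec [z zP [tz0 tz]]] := tP.
have t'P : canonical_symmetrizing_form zeta t'.
  split.
  - split=> [h h'|f]; first by rewrite !t'E !tauM tC.
    pose gf h := sg (f (tau' h)).
    have gfL : linear_for *%R gf.
      by move=> a h h'; rewrite /gf tau'L linearP rmorphD rmorphM sg'K.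
    pose g : {scalar generic_hecke x0} := HB.pack_for {scalar generic_hecke x0} gf
      (GRing.isLinear.Build _ _ _ _ gf gfL).
    have gE h : g h = sg (f (tau' h)) by [].
    have [h [hP hU]] := tND g.
    exists (tau' h); split=> [h'|h2 h2P].
      by rewrite t'E tauM tau'K -hP gE tauK sgK.
    rewrite -[h2]tauK; congr tau'; apply: hU => h'.
    by rewrite gE h2P t'E tauM tau'K sg'K.
  - by move=> a w aw; rewrite -(tspec _ _ aw) t'gen sg'_spec X_spec.
  exists z => //; split=> [|a].
    rewrite t'gen => /(congr1 sg); rewrite sg'K rmorph0 => Xz; apply: tz0.
    by rewrite -[LHS]mul1r -X0 -(addNr (ell z)) XD -mulrA Xz mulr0.
  rewrite !t'gen inv_sg' inv_X -rmorphM ellV opprK; congr (sg' _).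
  by rewrite mulrACA -XD -ellM tz.
move=> k01 b k tk.
have tT : sg (t (T b)) = X (ell b) * t (T b).
  by rewrite -{1}(t_unique t'P) t'gen sg'K.
apply/eqP; rewrite -subr_eq0; apply/negPn/negP => c0.
set c := weighted_degree N k - ell b in c0.
(* Iterating the translation produces infinitely many exponents if [c] is nonzero. *)
have step (i : nat) : ga_coef (t (T b)) (exponent_scale k0 (i%:Z * c) * k)%g != 0.
  elim: i => [|i IH].
    by rewrite mul0r (_ : (_ * k)%g = k) //; apply/ffunP => i; rewrite exponentE ffunE mul0r add0r.
  set k' := (exponent_scale k0 (i%:Z * c) * k)%g in IH.
  have : ga_coef (t (T b)) k' = ga_coef (t (T b)) (exponent_scale k0 c * k')%g.
    have /ga_eqP/(_ (shear N k0 1 k')) := tT.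
    rewrite sgE K1 coefX => ->; congr ga_coef; apply/ffunP => r.
    rewrite !exponentE !ffunE mul1r weighted_degreeM weighted_degree_scale // add0r /c.
    ring.
  move=> E1; move: IH; rewrite E1; congr (ga_coef _ _ != 0).
  by apply/ffunP => r; rewrite !exponentE !ffunE -addn1 PoszD; ring.
have [r kr] : exists r, k0 r != 0.
  apply/existsP; apply: contraT; rewrite negb_exists => /forallP k00; case/negP: k01.
  by apply/eqP/ffunP => r; rewrite exponent1; apply/eqP; move: (k00 r); rewrite negbK.
pose s := ga_supp (t (T b)).
have : {subset [seq (exponent_scale k0 (i%:Z * c) * k)%g | i <- seq.iota 0 (size s).+1] <= s}.
  by move=> _ /mapP[i _ ->]; rewrite mem_ga_supp step.
move=> sub; suff /uniq_leq_size/(_ sub) :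
    uniq [seq (exponent_scale k0 (i%:Z * c) * k)%g | i <- seq.iota 0 (size s).+1].
  by rewrite size_map size_iota ltnn.
rewrite map_inj_uniq ?iota_uniq // => i j /ffunP/(_ r).
rewrite !exponentE !ffunE => /addIr /(mulIf kr) /(mulIf c0); by case.
Qed.
End Homogeneity.

(** * Lifting elements of the reflection group to braids *)

Section Continuity.
Context (R : realType).
Local Notation C := (R[i] : numFieldType).

Lemma real_complex_continuous : continuous (fun x : R => x%:C%C : C).
Proof.
move=> x; apply/cvgrPdist_lt => /= e e0.
have [r [re r0]] : exists r : R, e = r%:C%C /\ 0 < r.
  case: e e0 => a b; rewrite ltcE /= => /andP[/eqP -> a0]; by exists a.
near=> t; rewrite -rmorphB /= normc_def /= expr0n addr0 sqrtr_sqr re ltcR.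
near: t; by apply: cvgr_dist_lt r0.
Unshelve. all: end_near.
Qed.

Lemma complex_continuous (T : topologicalType) (f g : T -> R) :
  continuous f -> continuous g -> continuous (fun t => (f t +i* g t)%C : C).
Proof.
move=> cf cg t.
have -> : (fun t => (f t +i* g t)%C : C) =
    (fun t => ((f t)%:C)%C + (0 +i* 1)%C * ((g t)%:C)%C : C).
  apply/funext => s; apply/eqP; rewrite eq_complex /=.
  by rewrite !(mul0r, mul1r, mulr0, subr0, addr0, add0r) !eqxx.
apply: cvgD.
  by apply: (continuous_comp (cf t)); exact: real_complex_continuous.
apply: cvgM; first exact: cvg_cst.
by apply: (continuous_comp (cg t)); exact: real_complex_continuous.
Qed.

Lemma matrix_continuous (T U : topologicalType) (p q : nat) (f : T -> 'M[U]_(p, q)) :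
  (forall i j, continuous (fun t => f t i j)) -> continuous f.
Proof.
move=> cf t A [P fP PA]; rewrite /= /nbhs /=.
have : \forall s \near t, forall i j, P i j (f s i j).
  by apply: filter_forall => i; apply: filter_forall => j; exact: cf (fP i j).
by apply: filterS => s Ps; exact: PA.
Qed.

Lemma mulmx_continuous (T : topologicalType) (p q : nat) (A : 'M[C]_(p, q))
    (f : T -> 'cV[C]_q) :
  continuous f -> continuous (fun t => A *m f t : 'cV[C]_p).
Proof.
move=> cf; apply: matrix_continuous => i j.
have ck k : continuous (fun t => A i k * f t k j : C).
  move=> t; apply: cvgM; first exact: cvg_cst.
  apply: (@continuous_comp _ _ _ f (fun M : 'cV[C]_q => M k j)); first exact: cf.
  exact: coord_continuous.
have addc : continuous (fun z : C * C => z.1 + z.2) by exact: add_continuous.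
rewrite (_ : (fun _ => _) = (fun t => \sum_k A i k * f t k j)).
  exact: (@continuous_big _ _ _ 0 xpredT addc _ _ _ (fun k _ => ck k)).
by apply/funext => t; rewrite mxE.
Qed.

Lemma affine_continuous (T : topologicalType) (p : nat) (z : T -> C) (h l : 'cV[C]_p) :
  continuous z -> continuous (fun t => h + z t *: l : 'cV[C]_p).
Proof.
move=> cz; apply: matrix_continuous => i j.
rewrite (_ : (fun _ => _) = (fun t => h i j + z t * l i j)); last first.
  by apply/funext => t; rewrite !mxE.
move=> t; apply: cvgD; first exact: cvg_cst.
by apply: cvgM; [exact: cz|exact: cvg_cst].
Qed.
End Continuity.

Section Lifts.
Context (R : realType) (K : splittingFieldType rat) (iota : {rmorphism K -> R[i]}).
Context (n : nat) (W : finGroupType) (rW : mx_representation K [set: W]%G n).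
Local Notation C := (R[i] : numFieldType).
Local Notation V := (Vreg iota rW).

Lemma hyperplaneC_linear H (c : C) (x y : 'cV[C]_n) :
  hyperplaneC iota (rW := rW) H x -> hyperplaneC iota H y -> hyperplaneC iota H (c *: x + y).
Proof.
move=> [a ->] [b ->]; exists (fun i => c * a i + b i).
rewrite scaler_sumr -big_split; apply: eq_bigr => i _ /=.
by rewrite scalerDl scalerA.
Qed.

Lemma hyperplaneC0 H : hyperplaneC iota (rW := rW) H (0 : 'cV[C]_n).
Proof. by exists (fun=> 0); rewrite big1 // => i _; rewrite scale0r. Qed.

Lemma hyperplaneC_map H (v : 'cV[K]_n) :
  v \in hyperplane_space H -> hyperplaneC iota (rW := rW) H (map_mx iota v : 'cV[C]_n).
Proof.
move=> vH; exists (fun i => iota (coord (vbasis (hyperplane_space H)) i v)).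
rewrite [in LHS](coord_vbasis vH); apply/matrixP => r q.
by rewrite !mxE !summxE rmorph_sum; apply: eq_bigr => i _; rewrite !mxE rmorphM.
Qed.

Lemma fixed_pointsP (w : W) v : (v \in fixed_points rW w) = (rW w *m v == v).
Proof. by apply/fixedSpaceP/eqP; rewrite lfunE. Qed.

(** If [H] is fixed by the reflection [g], its image under [w] is fixed by the
    reflection [w g w^-1]. *)
Lemma conj_hyperplane (w : W) (H : hyperplane rW) : exists H' : hyperplane rW,
  forall v, v \in hyperplane_space H -> rW w *m v \in hyperplane_space H'.
Proof.
have /mapP[g] := ssvalP H; rewrite mem_filter => /andP[gr _] HE.
pose g' := (w * g * w^-1)%g.
have rWM (a b : W) : rW (a * b)%g = rW a *m rW b by rewrite repr_mxM ?inE.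
have wg v : v \in fixed_points rW g -> rW w *m v \in fixed_points rW g'.
  rewrite !fixed_pointsP => /eqP gv.
  by rewrite mulmxA -rWM /g' mulgKV rWM -mulmxA gv.
have g'r : is_pseudo_reflection rW g'.
  suff dE : \dim (fixed_points rW g') = \dim (fixed_points rW g).
    by rewrite /is_pseudo_reflection dE; exact: gr.
  have gE : (linfun (mulmx (rW w)) @: fixed_points rW g)%VS = fixed_points rW g'.
    apply/eqP; rewrite eqEsubv; apply/andP; split; apply/subvP => v.
      by move=> /memv_imgP[u /wg ug ->]; rewrite lfunE.
    move=> vg'; apply/memv_imgP; exists (rW w^-1%g *m v); last first.
      by rewrite lfunE /= mulmxA -rWM mulgV repr_mx1 mul1mx.
    move: vg'; rewrite !fixed_pointsP => /eqP gv.
    by rewrite -{2}gv !mulmxA -!rWM /g' !mulgA mulVg mul1g.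
  rewrite -gE; apply/limg_dim_eq/eqP; rewrite -subv0; apply/subvP => v.
  rewrite memv_cap memv_ker lfunE /= memv0 => /andP[_ /eqP wv].
  by rewrite -[v]mul1mx -(repr_mx1 rW) -(mulVg w) rWM -mulmxA wv mulmx0.
have g's : fixed_points rW g' \in [seq fixed_points rW w | w <- enum W & is_pseudo_reflection rW w].
  by apply: map_f; rewrite mem_filter g'r mem_enum.
exists (SeqSub g's) => v; rewrite /hyperplane_space HE; exact: wg.
Qed.

Lemma actC_hyperplane (w : W) (H : hyperplane rW) : exists H' : hyperplane rW,
  forall x : 'cV[C]_n, hyperplaneC iota H x -> hyperplaneC iota H' (actC iota rW w x).
Proof.
have [H' HH'] := conj_hyperplane w H; exists H' => _ [a ->].
rewrite /actC mulmx_sumr; elim/big_ind : _ => [|x y Hx Hy|i _].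
- exact: hyperplaneC0.
- by rewrite -[x]scale1r; exact: hyperplaneC_linear.
rewrite -scalemxAr -map_mxM -[X in hyperplaneC _ _ X]addr0.
apply: hyperplaneC_linear; last exact: hyperplaneC0.
by apply: hyperplaneC_map; apply: HH'; apply: vbasis_mem; apply: mem_nth; rewrite size_tuple.
Qed.

Lemma Vreg_actC (w : W) (x : V) : Vreg iota rW (actC iota rW w (val x)).
Proof.
move=> H Hx; have [H' HH'] := actC_hyperplane w^-1 H.
have /set_mem/(_ H') := valP x; apply.
by have := HH' _ Hx; rewrite -actCM mulVg actC1.
Qed.

Definition actV (w : W) (x : V) : V :=
  exist (fun y => y \in (V : set _)) (actC iota rW w (val x)) (mem_set (@Vreg_actC w x)).

Lemma to_orbit_actV w x : to_orbit (actV w x) = to_orbit x.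
Proof.
apply/eqmodP/existsP; exists w^-1%g.
by rewrite /= -actCM mulVg actC1.
Qed.

Lemma Vreg_continuous (T : topologicalType) (f : T -> V) :
  continuous (fun t => val (f t)) -> continuous f.
Proof. by move=> cf; apply: (@continuous_comp_initial _ _ _ set_val f). Qed.

Lemma Vreg_within_continuous (f : R -> V) (g : R -> 'cV[C]_n) :
  continuous g -> (forall t, 0 <= t <= 1 -> g t = val (f t)) ->
  ({within `[0, 1], continuous f})%classic.
Proof.
move=> cg gf; apply: Vreg_continuous.
have cvf : ({within `[0, 1], continuous (fun t => val (f t) : 'cV[C]_n)})%classic.
  apply: (@within_eq _ _ _ g).
    by move=> t /=; rewrite in_itv /=; exact: gf.
  exact: continuous_subspaceT.
exact: cvf.
Qed.

Lemma actV_continuous w : continuous (actV w).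
Proof.
apply: Vreg_continuous.
apply: mulmx_continuous; exact: initial_continuous.
Qed.

Lemma Vreg_line_meets_once (x : V) (d : 'cV[C]_n) (H : hyperplane rW) (z z' : C) :
  hyperplaneC iota H (val x + z *: d) -> hyperplaneC iota H (val x + z' *: d) -> z = z'.
Proof.
move=> Hz Hz'; apply/eqP; rewrite -subr_eq0; apply/negPn/negP => zz'.
have Hd : hyperplaneC iota H ((z - z') *: d).
  have := hyperplaneC_linear (-1) Hz' Hz.
  by rewrite scaleN1r opprD addrACA addNr add0r -scaleNr -scalerDl addrC.
have /set_mem/(_ H) := valP x; apply.
have := hyperplaneC_linear (- z / (z - z')) Hd Hz.
by rewrite scalerA divfK // scaleNr addrC addrK.
Qed.

(** Arcs of parabolas from 0 to 1 in the complex plane, pairwise disjoint away from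
    their ends. *)
Definition detour (c t : R) : C := (t +i* (c * (t * (1 - t))))%C.

Lemma detour_continuous c : continuous (detour c).
Proof.
apply: complex_continuous => t; first exact: cvg_id.
apply: cvgM; first exact: cvg_cst.
by apply: cvgM; [exact: cvg_id|apply: cvgB; [exact: cvg_cst|exact: cvg_id]].
Qed.

(** Each hyperplane meets the complex line through [x] and [y] in at most one point,
    which lies on at most one of the arcs.  There are more arcs than
    hyperplanes. *)
Lemma detour_avoids (x y : V) : exists c : R, forall t, 0 <= t <= 1 ->
  Vreg iota rW (val x + detour c t *: (val y - val x)).
Proof.
apply: contrapT => bad.
have /choice [p pP] (k : nat) : exists p : hyperplane rW * R, 0 <= p.2 <= 1 /\
    hyperplaneC iota p.1 (val x + detour k%:R p.2 *: (val y - val x)).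
  apply: contrapT => no; apply: bad; exists k%:R => t t01 H Ht; apply: no.
  by exists (H, t).
have inj (i j : nat) : (p i).1 = (p j).1 -> i = j.
  move=> ij; have [_ Hi] := pP i; have [_ Hj] := pP j; rewrite ij in Hi.
  have := Vreg_line_meets_once Hi Hj => -[tij]; rewrite -tij.
  set t := (p i).2 in Hi *.
  have t0 : t != 0.
    apply/eqP => t0; have /set_mem/(_ (p j).1) := valP x; apply.
    by move: Hi; rewrite /detour t0 mul0r mulr0 scale0r addr0.
  have t1 : 1 - t != 0.
    apply/eqP => t1; have /set_mem/(_ (p j).1) := valP y; apply.
    have tE : t = 1 by apply/eqP; rewrite eq_sym -subr_eq0 t1.
    by move: Hi; rewrite /detour t1 !mulr0 tE -[(1 +i* 0)%C]/(1 : C) scale1r addrC subrK.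
  move=> /(mulIf (mulf_neq0 t0 t1)) /eqP; by rewrite eqr_nat => /eqP.
have : (#|'I_(#|{: hyperplane rW}|.+1)| <= #|{: hyperplane rW}|)%N.
  apply: (leq_card (fun i : 'I__ => (p i).1)) => i j /inj; exact: val_inj.
by rewrite card_ord ltnn.
Qed.

Lemma Vreg_path_connected (x y : V) : exists f : R -> V, is_path x y f.
Proof.
have [c cP] := detour_avoids x y.
pose g t : 'cV[C]_n := val x + detour c t *: (val y - val x).
have /choice [f fP] : forall t : R, exists v : V, 0 <= t <= 1 -> g t = val v.
  move=> t; have [t01|t01] := boolP (0 <= t <= 1); last by exists x.
  by exists (exist (fun y => y \in (V : set _)) (g t) (mem_set (cP t t01))).
exists f; split.
- apply: (Vreg_within_continuous (g := g)) => //.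
  by apply: affine_continuous; exact: detour_continuous.
- apply: val_inj; rewrite -fP ?lexx ?ler01 // /g /detour mul0r mulr0.
  by rewrite -[(0 +i* 0)%C]/(0 : C) scale0r addr0.
- apply: val_inj; rewrite -fP ?lexx ?ler01 // /g /detour subrr !mulr0.
  by rewrite -[(1 +i* 0)%C]/(1 : C) scale1r addrC subrK.
Qed.

Context (x0 : V).
Local Notation B := (braid_group x0).

Lemma lifts_exist (w : W) : exists b : B, lifts_to b w.
Proof.
have [f fP] := Vreg_path_connected x0 (actV w x0).
by exists (pi1_class (to_orbit x0) (@to_orbit R K iota n W rW \o f)), (actV w x0), f.
Qed.

Lemma lifts_to1 : lifts_to (1%g : B) 1%g.
Proof.
exists x0, (cst x0); split; rewrite ?actC1 //; first exact: path_cst.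
rewrite /pi1_class; congr (\pi_(pi1 _ _) _)%qT; apply: val_inj.
rewrite insubdK //; apply/asboolP; exact: path_cst.
Qed.

Lemma expi_continuous (a : R) : continuous (fun t => expi (a * t) : C).
Proof.
have ca : continuous (fun t : R => a * t).
  by move=> t; apply: cvgM; [exact: cvg_cst|exact: cvg_id].
apply: complex_continuous => t.
  by apply: (continuous_comp (ca t)); exact: continuous_cos.
by apply: (continuous_comp (ca t)); exact: continuous_sin.
Qed.

Lemma pointwise_stabilizerP (H : hyperplane rW) (s : W) (h : 'cV[C]_n) :
  s \in pointwise_stabilizer H -> hyperplaneC iota H h -> actC iota rW s h = h.
Proof.
rewrite inE => /subvP sH [a ->]; rewrite /actC mulmx_sumr; apply: eq_bigr => i _.
rewrite -scalemxAr -map_mxM; congr (_ *: map_mx _ _).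
apply/eqP; rewrite -fixed_pointsP; apply: sH; apply: vbasis_mem.
by apply: mem_nth; rewrite size_tuple.
Qed.

(** The loop runs along [gamma], the arc, and [gamma] backwards.  Since [s] fixes
    [h] and multiplies [l] by [zetaC e], the arc ends at [s xH], so replacing the
    last piece by its image under [s] gives a path upstairs. *)
Lemma monodromy_lifts O (b : B) : monodromy_generator O b -> exists w, lifts_to b w.
Proof.
move=> [H [s [h [l [xH [gamma [arc]]]]]]] /= [[HO sH _] [hH sl xHE] _ [gP arcE] bE].
have e0 : (#|pointwise_stabilizer H|%:R : R) != 0.
  rewrite pnatr_eq0 -lt0n card_gt0; apply/set0Pn; by exists s.
set e := #|pointwise_stabilizer H| in sl arcE e0.
have {}xHE : val xH = h + l := xHE.
have {}arcE t : 0 <= t <= 1 -> val (arc t) = h + expi (2 * pi * t / e%:R) *: l := arcE t.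
have actM : val (actV s xH) = h + zetaC R e *: l.
  by rewrite /= xHE /actC mulmxDr -!/(actC _ _ _ _) sl (pointwise_stabilizerP sH hH).
have arcP : is_path xH (actV s xH) arc.
  split.
  - apply: (Vreg_within_continuous (g := fun t => h + expi (2 * pi / e%:R * t) *: l)).
      by apply: affine_continuous; exact: expi_continuous.
    by move=> t t01; rewrite arcE // mulrAC.
  - apply: val_inj; rewrite arcE ?lexx ?ler01 // xHE mulr0 mul0r /expi cos0 sin0.
    by rewrite -[(1 +i* 0)%C]/(1 : C) scale1r.
  - by apply: val_inj; rewrite arcE ?lexx ?ler01 // actM mulr1.
have rP : is_path (actV s xH) (actV s x0) (actV s \o reverse gamma).
  have [cr r0 r1] := path_reverse gP; split; rewrite /= ?r0 ?r1 //.
  apply: (@within_continuous_comp _ _ _ _ (reverse gamma) (actV s)) => // y _.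
  exact: actV_continuous.
exists s, (actV s x0), (concat (concat gamma arc) (actV s \o reverse gamma)); split=> //.
  exact: path_concat (path_concat gP arcP) rP.
rewrite bE; congr pi1_class; apply/funext => t; rewrite /concat /reverse /=.
case: ifP => _; first by case: ifP.
by rewrite to_orbit_actV.
Qed.
End Lifts.

(** * Specialization and valuation on K(y) *)

(** The function [val_y] is computed from the representative [repr f]; with
    [frac_cross] this shows that any other fraction gives the same value. *)
Lemma frac_repr (R : idomainType) (f : {fraction R}) :
  f = (frac (repr f)).1%:F / (frac (repr f)).2%:F.
Proof.
have d0 : (frac (repr f)).2 != 0 by exact: denom_ratioP.
apply: (mulIf (x := (frac (repr f)).2%:F)); first by rewrite tofrac_eq0.
rewrite divfK ?tofrac_eq0 //.
move: (repr f) d0 (reprK f) => x d0 <-; unlock FracField.tofrac.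
rewrite -[LHS]FracField.pi_mul; apply/eqmodP.
rewrite /= FracField.equivfE /FracField.mulf !numden_Ratio ?oner_eq0 ?mulr1 //.
by apply/eqP; exact: mulrC.
Qed.

Lemma frac_cross (R : idomainType) (p q a b : R) : q != 0 -> b != 0 ->
  p%:F / q%:F = a%:F / b%:F -> p * b = a * q.
Proof.
move=> q0 b0 /eqP; rewrite eqr_div ?tofrac_eq0 // -!tofracM tofrac_eq.
by move/eqP.
Qed.

Section FractionSpecialization.
Context (K : splittingFieldType rat).
Local Notation Ky := {fraction {poly K}}.
Local Notation y := ('X%:F : Ky).

Lemma val_yE (p q : {poly K}) : p != 0 -> q != 0 ->
  val_y (p%:F / q%:F) = (mup 0 p)%:Z - (mup 0 q)%:Z.
Proof.
move=> p0 q0; have := frac_repr (p%:F / q%:F); rewrite /val_y.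
set x := repr _; have b0 : (frac x).2 != 0 by exact: denom_ratioP.
move: (frac x) b0 => [a b] /= b0 /(frac_cross q0 b0) pb.
have a0 : a != 0.
  by apply: contraNneq (mulf_neq0 p0 b0) => a0; rewrite pb a0 mul0r.
have := congr1 (mup 0) pb; rewrite !mupM // => /(congr1 Posz); rewrite !PoszD => E.
apply/eqP; rewrite subr_eq addrAC eq_sym subr_eq; apply/eqP; rewrite E; lia.
Qed.

Lemma frac_neq0P (f : Ky) : f != 0 ->
  exists p q : {poly K}, [/\ p != 0, q != 0 & f = p%:F / q%:F].
Proof.
move=> f0; exists (frac (repr f)).1, (frac (repr f)).2; split; last exact: frac_repr.
  by apply: contraNneq f0 => n0; rewrite (frac_repr f) n0 tofrac0 mul0r.
exact: denom_ratioP.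
Qed.

Lemma val_yM (f g : Ky) : f != 0 -> g != 0 -> val_y (f * g) = val_y f + val_y g.
Proof.
move=> /frac_neq0P[p [q [p0 q0 ->]]] /frac_neq0P[r [s [r0 s0 ->]]].
rewrite mulf_div -!tofracM !val_yE ?mulf_neq0 // !mupM // !PoszD; lia.
Qed.

Lemma val_y1 : val_y (1 : Ky) = 0.
Proof. by apply: (addrI (val_y (1 : Ky))); rewrite -val_yM ?oner_neq0 // mulr1 addr0. Qed.

Lemma val_yV (f : Ky) : f != 0 -> val_y f^-1 = - val_y f.
Proof.
by move=> f0; apply/eqP; rewrite -addr_eq0 -val_yM ?invr_neq0 // mulVf // val_y1.
Qed.

Lemma y_neq0 : y != 0.
Proof. by rewrite tofrac_eq0 polyX_eq0. Qed.

Lemma val_yX : val_y y = 1.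
Proof.
have := @val_yE 'X 1; rewrite tofrac1 divr1 polyX_eq0 oner_eq0 => -> //.
have -> : mup 0 ('X : {poly K}) = 1%N.
  by have := mup_XsubCX 1 (0 : K) 0; rewrite eqxx expr1 polyC0 subr0.
by rewrite mupNroot ?root1.
Qed.

Lemma specializes_unique (f : Ky) a b : specializes_to f a -> specializes_to f b -> a = b.
Proof.
move=> [p [q [q1 -> ->]]] [p' [q' [q'1 fE ->]]].
have nz (r : {poly K}) : r.[1] != 0 -> r != 0.
  by apply: contraNneq => ->; rewrite horner0.
have E := frac_cross (nz _ q1) (nz _ q'1) fE.
by apply/eqP; rewrite eqr_div // -!hornerM E.
Qed.

Lemma specializes_cst (a : K) : specializes_to a%:P%:F a.
Proof. by exists a%:P, (1 : {poly K}); rewrite !hornerE oner_eq0 tofrac1 !divr1. Qed.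

Lemma specializesM (f g : Ky) a b :
  specializes_to f a -> specializes_to g b -> specializes_to (f * g) (a * b).
Proof.
move=> [p [q [q1 -> ->]]] [p' [q' [q'1 -> ->]]]; exists (p * p'), (q * q').
by rewrite !hornerM mulf_neq0 // !tofracM !mulf_div.
Qed.

Lemma specializes_expyz (k : int) : specializes_to (y ^ k) 1.
Proof.
case: k => k.
  exists ('X^k : {poly K}), (1 : {poly K}).
  by rewrite !hornerE expr1n oner_eq0 tofrac1 !divr1 tofracXn.
exists (1 : {poly K}), ('X^(k.+1) : {poly K}); rewrite !hornerE expr1n oner_eq0 tofracXn invr1.
by split=> //; rewrite NegzE exprnN.
Qed.

Lemma specializes_nat (n : nat) : specializes_to (n%:R : Ky) n%:R.
Proof.
have := specializes_cst n%:R; by rewrite polyC_natr rmorph_nat.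
Qed.

Lemma fraction_char0 (n : nat) : n.+1%:R != 0 :> Ky.
Proof.
have -> : n.+1%:R = (n.+1%:R : K)%:P%:F :> Ky by rewrite polyC_natr rmorph_nat.
rewrite tofrac_eq0 polyC_eq0; by rewrite -(rmorph_nat (in_alg K)) fmorph_eq0 pnatr_eq0.
Qed.
End FractionSpecialization.

(** * Roots of unity and orbits of hyperplanes *)

Section RootsOfUnity.
Context (R : realType).

Lemma expiD (a b : R) : expi (a + b) = expi a * expi b.
Proof.
by apply/eqP; rewrite eq_complex /= cosD sinD [X in _ && (X == _)]addrC; apply/andP; split.
Qed.

Lemma zetaC_exp (e k : nat) : zetaC R e ^+ k = expi (2 * pi * (k%:R / e%:R)).
Proof.
elim: k => [|k IH]; first by rewrite expr0 mul0r mulr0 /expi cos0 sin0.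
rewrite exprSr IH /zetaC -expiD; congr expi.
by rewrite -[k.+1%:R]natr1 [(_ + 1) / _]mulrDl mul1r [RHS]mulrDr.
Qed.

Lemma zetaC_exp_order (e : nat) : (0 < e)%N -> zetaC R e ^+ e = 1.
Proof.
move=> e0; rewrite zetaC_exp divff ?pnatr_eq0 -?lt0n // mulr1 /expi.
by rewrite mulr_natl cos2pi sin2pi.
Qed.

Lemma zetaC_primitive (e k : nat) : (k < e)%N -> zetaC R e ^+ k = 1 -> k = 0%N.
Proof.
move=> ke; rewrite zetaC_exp => -[c1 _]; apply/eqP; rewrite -leqn0 leqNgt; apply/negP => k0.
have e0 : 0 < e%:R :> R by rewrite ltr0n (leq_trans _ ke).
have kR : 0 < k%:R :> R by rewrite ltr0n.
have r0 : 0 < k%:R / e%:R :> R by rewrite divr_gt0.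
have r1 : k%:R / e%:R < 1 :> R by rewrite ltr_pdivrMr // mul1r ltr_nat.
have s0 : 0 < sin (pi * (k%:R / e%:R) : R).
  apply: sin_gt0_pi; rewrite mulr_gt0 ?pi_gt0 //=.
  by rewrite -[X in _ < X]mulr1 ltr_pM2l ?pi_gt0.
(* The half angle lies strictly between 0 and [pi], so its sine is nonzero. *)
have : cos (2 * pi * (k%:R / e%:R)) = 1 - 2 * sin (pi * (k%:R / e%:R) : R) ^+ 2.
  rewrite -mulrA mulr_natl cos_mulr2n cos2sin2 -mulr_natl; ring.
rewrite c1 => /eqP; rewrite eq_sym subr_eq addrC -subr_eq subrr eq_sym mulf_eq0 pnatr_eq0 /=.
by rewrite sqrf_eq0 gt_eqF.
Qed.
End RootsOfUnity.

Section Orbits.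
Context (R : realType) (K : splittingFieldType rat) (iota : {rmorphism K -> R[i]}).
Context (n : nat) (W : finGroupType) (rW : mx_representation K [set: W]%G n).

(** A hyperplane is by definition fixed by a reflection, which differs from 1. *)
Lemma orbit_order_gt1 (O : hyperplane_orbit rW) : (1 < orbit_order O)%N.
Proof.
have /imsetP[H _ OE] := valP O.
have HO : H \in val O.
  rewrite OE !inE /=; apply/existsP; exists 1%g; apply/eqP.
  rewrite (_ : linfun _ = \1%VF) ?lim1g //.
  by apply/lfunP => v; rewrite !lfunE /= repr_mx1 mul1mx.
apply: leq_trans (leq_bigmax_cond _ HO).
have /mapP[g] := ssvalP H; rewrite mem_filter => /andP[gr _] HE.
have g1 : g != 1%g.
  apply: contraL gr => /eqP ->; rewrite /is_pseudo_reflection.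
  have -> : fixed_points rW 1 = fullv.
    by apply/eqP; rewrite eqEsubv subvf; apply/subvP => v _; rewrite fixed_pointsP repr_mx1 mul1mx.
  by rewrite dimvf /dim /= muln1 -addn1 -[X in _ != X]addn0 eqn_add2l.
suff : (#|[set 1%g; g]| <= #|pointwise_stabilizer H|)%N by rewrite cards2 eq_sym g1.
apply: subset_leq_card; apply/fintype.subsetP => w; rewrite !inE => /orP[]/eqP->.
  by apply/subvP => v _; rewrite fixed_pointsP repr_mx1 mul1mx.
by rewrite /hyperplane_space HE subvv.
Qed.

Lemma weight_fixed_cst (nu : weight rW) : weight_fixed nu ->
  forall O (j k : 'I_(orbit_order O)), nu O j = nu O k.
Proof.
move=> nuG O; pose z : 'I_(orbit_order O) := Ordinal (ltnW (orbit_order_gt1 O)).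
suff nz j : nu O j = nu O z by move=> j k; rewrite !nz.
(* A shift must be given for all orbits at once; only its value at [O] matters. *)
pose g (O' : hyperplane_orbit rW) : 'I_(orbit_order O') :=
  Ordinal (ltn_pmod j (ltnW (orbit_order_gt1 O'))).
rewrite -(nuG g O z) /weight_shift; congr (nu O _); apply: val_inj => /=.
by rewrite add0n modn_mod modn_small.
Qed.

Context (zeta : hyperplane_orbit rW -> K).
Hypothesis zetaP : forall O, iota (zeta O) = zetaC R (orbit_order O).

Lemma zeta_exp_order O : zeta O ^+ orbit_order O = 1.
Proof.
apply: (fmorph_inj iota); rewrite rmorphXn rmorph1 zetaP zetaC_exp_order //.
exact: ltnW (orbit_order_gt1 O).
Qed.

Lemma zeta_neq0 O : zeta O != 0.
Proof.
apply: contra_eq_neq (zeta_exp_order O) => ->.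
by rewrite expr0n gtn_eqF 1?eq_sym ?oner_neq0 // ltnW // orbit_order_gt1.
Qed.

Lemma zeta_primitive O (j : 'I_(orbit_order O)) : zeta O ^+ j = 1 -> j = 0%N :> nat.
Proof.
move=> /(congr1 iota); rewrite rmorphXn rmorph1 zetaP; exact: zetaC_primitive.
Qed.
End Orbits.

(** * The degree of a braid *)

Section Isomorphism.
Context (F : fieldType) (T : Type).

Lemma isomorphic_trace d e (f : T -> 'M[F]_d) (g : T -> 'M[F]_e) :
  isomorphic f g -> forall x, \tr (f x) = \tr (g x).
Proof.
move=> [P /andP[/row_freeP[Q PQ] /row_fullP[Q' Q'P]] PI] x.
have QQ' : Q' = Q by rewrite -[Q']mulmx1 -PQ mulmxA Q'P mul1mx.
by rewrite -[f x]mul1mx -Q'P -mulmxA PI QQ' mxtrace_mulC -mulmxA PQ mulmx1.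
Qed.

Lemma irreducible_dim1 (f : T -> 'M[F]_1) : irreducible f.
Proof.
split=> // U _; have := dimvS (subvf U); rewrite dimvf /dim /= muln1.
case dU: (\dim U) => [|[|//]] _; first by left; apply/eqP; rewrite -dimv_eq0 dU.
by right; apply/eqP; rewrite eqEdim subvf dimvf /dim /= muln1 dU.
Qed.
End Isomorphism.

Lemma trivial_index (F : fieldType) (W : finGroupType) (Lambda : finType)
    (d : Lambda -> nat) (rho : forall l, W -> 'M[F]_(d l)) :
  indexes_Irr (@mx_repr F W [set: W]%SET) rho ->
  exists l, forall w, \tr (rho l w) = 1.
Proof.
move=> [_ _ /(_ 1%N (fun=> 1%:M)) []].
- by split=> // x y _ _; rewrite mulmx1.
- exact: irreducible_dim1.
move=> l iso; exists l => w; rewrite -(isomorphic_trace iso).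
by rewrite mxtrace1.
Qed.

Section Valuation.
Context (K : splittingFieldType rat).
Local Notation Ky := {fraction {poly K}}.
Local Notation y := ('X%:F : Ky).

Lemma expyz_neq0 (k : int) : y ^ k != 0.
Proof. by rewrite expfz_neq0 // y_neq0. Qed.

Lemma val_y_expyz (k : int) : val_y (y ^ k) = k.
Proof.
have nat_case (i : nat) : val_y (y ^ i%:Z) = i%:Z.
  elim: i => [|i IH]; first by rewrite expr0z val_y1.
  by rewrite -addn1 PoszD expfzDr ?y_neq0 // val_yM ?expyz_neq0 // IH expr1z val_yX.
case: k => k //; by rewrite NegzE -invr_expz val_yV ?expyz_neq0 // nat_case.
Qed.
End Valuation.

Section LinearCharacters.
Context (R : realType) (K : splittingFieldType rat) (iota : {rmorphism K -> R[i]}).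
Context (n : nat) (W : finGroupType) (rW : mx_representation K [set: W]%G n).
Context (x0 : Vreg iota rW) (zeta : hyperplane_orbit rW -> K).
Hypothesis zetaP : forall O, iota (zeta O) = zetaC R (orbit_order O).
Local Notation B := (braid_group x0).
Local Notation Ky := {fraction {poly K}}.
Local Notation y := ('X%:F : Ky).
Local Notation mu := (mu_order K).

Lemma cyclotomic_param_expz (m : weight rW) i :
  cyclotomic_param zeta m i =
  (zeta (tag i) ^+ tagged i)%:P%:F * y ^ (mu%:Z * m (tag i) (tagged i)).
Proof. by rewrite /cyclotomic_param [mu%:Z * _]mulrC -exprz_exp. Qed.

(** The traces specialize to 1 at the trivial braid, so [f] has dimension 1.  On a
    monodromy generator its value is a root [zeta^j y^(mu m_j)] of the defining
    relation; the generator lifts an element of [W], so the value specializes to 1,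
    which forces [zeta^j = 1] and [j = 0]. *)
Lemma linear_character (m : weight rW) d (f : cyclotomic_hecke x0 zeta m -> 'M[Ky]_d) :
  hecke_rep f ->
  (forall b w, lifts_to b w -> specializes_to (\tr (f (hecke_gen _ b))) 1) ->
  exists psi : B -> Ky, [/\ forall b, psi b != 0,
    forall a b, psi (a * b)%g = psi a * psi b &
    forall O s (j : 'I_(orbit_order O)), monodromy_generator O s -> j = 0%N :> nat ->
      psi s = y ^ (mu%:Z * m O j)].
Proof.
move=> [flin f1 fM] fspec.
have d1 : d = 1%N.
  have := fspec _ _ (lifts_to1 x0); rewrite hecke_gen1 f1 mxtrace1 => /specializes_unique.
  move=> /(_ _ (specializes_nat K d)) /esym.
  rewrite -(rmorph_nat (in_alg K)) -[RHS](rmorph1 (in_alg K)) => /fmorph_inj/eqP.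
  by rewrite pnatr_eq1 => /eqP.
subst d; pose chi (h : hecke x0 (cyclotomic_param zeta m)) : Ky := f h 0 0.
have chiM h h' : chi (h * h') = chi h * chi h' by rewrite /chi fM mxE big_ord1.
have chi1 : chi 1 = 1 by rewrite /chi f1 mxE.
have chiL a h h' : chi (a *: h + h') = a * chi h + chi h' by rewrite /chi flin !mxE.
pose psi b := chi (hecke_gen _ b).
have psiM a b : psi (a * b)%g = psi a * psi b by rewrite /psi hecke_genM chiM.
have psi0 b : psi b != 0.
  have : psi b * psi b^-1%g != 0 by rewrite -psiM mulgV /psi hecke_gen1 chi1 oner_neq0.
  by apply: contraNneq => ->; rewrite mul0r.
exists psi; split=> // O s j sO j0.
pose u i := cyclotomic_param zeta m (Tagged (fun O => 'I_(orbit_order O)) i).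
have : chi (\prod_(i < orbit_order O) (hecke_gen _ s - u O i *: (1 : hecke x0 _))) = 0.
  rewrite hecke_relation_gen //; have := chiL (-1) 0 0.
  by rewrite scaleN1r addNr mulN1r addNr.
rewrite (big_morph chi chiM chi1) => /eqP/prodf_eq0[i _].
have -> : chi (hecke_gen _ s - u O i *: (1 : hecke x0 _)) = psi s - u O i.
  by rewrite addrC -scaleNr chiL chi1 mulr1 addrC.
rewrite subr_eq0 => /eqP psis.
have [w sw] := monodromy_lifts sO.
have := fspec _ _ sw; rewrite trace_mx11 -/(chi _) -/(psi s) psis /u cyclotomic_param_expz /=.
move=> /specializes_unique - /(_ _ (specializesM (specializes_cst _) (specializes_expyz _ _))).
rewrite mulr1 => /esym /(zeta_primitive zetaP) i0.
have -> : j = i by apply: val_inj; rewrite /= j0 i0.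
by rewrite i0 expr0 polyC1 tofrac1 mul1r.
Qed.
End LinearCharacters.

Section Degree.
Context (R : realType) (K : splittingFieldType rat) (iota : {rmorphism K -> R[i]}).
Context (n : nat) (W : finGroupType) (rW : mx_representation K [set: W]%G n).
Context (x0 : Vreg iota rW) (zeta : hyperplane_orbit rW -> K).
Hypothesis zetaP : forall O, iota (zeta O) = zetaC R (orbit_order O).
Local Notation B := (braid_group x0).
Local Notation Ky := {fraction {poly K}}.
Local Notation y := ('X%:F : Ky).
Local Notation mu := (mu_order K).
Context (nu : weight rW) (nuG : weight_fixed nu).

Definition param_degree (i : parameter rW) : int := mu%:Z * @nu (tag i) (tagged i).

(** The quotient of the two linear characters is [y^(mu * nu)] on the monodromy
    generators.  Its values at other braids need not be powers of [y], hence the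
    valuation. *)
Lemma degree_morphism (m : weight rW) d d'
    (f : cyclotomic_hecke x0 zeta m -> 'M[Ky]_d)
    (f' : cyclotomic_hecke x0 zeta (weight_add m nu) -> 'M[Ky]_d') :
  hecke_rep f -> hecke_rep f' ->
  (forall b w, lifts_to b w -> specializes_to (\tr (f (hecke_gen _ b))) 1) ->
  (forall b w, lifts_to b w -> specializes_to (\tr (f' (hecke_gen _ b))) 1) ->
  exists ell : B -> int, (forall a b, ell (a * b)%g = ell a + ell b) /\
    forall O s (j : 'I_(orbit_order O)), monodromy_generator O s ->
      ell s = param_degree (Tagged _ j).
Proof.
move=> fr f'r fs f's.
have [psi [psi0 psiM psis]] := linear_character zetaP fr fs.
have [psi' [psi'0 psi'M psi's]] := linear_character zetaP f'r f's.
exists (fun b => val_y (psi' b / psi b)); split=> [a b|O s j sO].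
  by rewrite psiM psi'M -mulf_div; apply: val_yM; rewrite mulf_neq0 ?invr_neq0 ?psi0 ?psi'0.
pose z : 'I_(orbit_order O) := Ordinal (ltnW (orbit_order_gt1 O)).
rewrite (psis O s z) // (psi's O s z) // val_yM ?invr_neq0 ?expyz_neq0 //.
rewrite val_yV ?expyz_neq0 // !val_y_expyz /param_degree /= (weight_fixed_cst nuG j z).
by rewrite /weight_add mulrDr addrAC subrr add0r.
Qed.

Lemma param_degree_shift (m : weight rW) i :
  cyclotomic_param zeta (weight_add m nu) i = y ^ param_degree i * cyclotomic_param zeta m i.
Proof.
rewrite !cyclotomic_param_expz mulrCA /weight_add mulrDr addrC expfzDr //.
exact: y_neq0.
Qed.

Lemma laurent_eval_shift (m : weight rW) (f : generic_ring rW) (e : int) :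
  (forall k, ga_coef f k != 0 -> weighted_degree param_degree k = e) ->
  laurent_eval (cyclotomic_param zeta (weight_add m nu)) f =
  y ^ e * laurent_eval (cyclotomic_param zeta m) f.
Proof.
move=> fe; rewrite /laurent_eval mulr_sumr; apply: eq_big_seq => k.
rewrite mem_ga_supp => /fe <-; rewrite mulrCA; congr (_ * _).
rewrite /weighted_degree (big_morph (fun c => y ^ c) (id1 := 1) (op1 := *%R)).
- rewrite -big_split; apply: eq_bigr => i _ /=.
  by rewrite param_degree_shift expfzMl exprz_exp.
- by move=> a b; rewrite expfzDr // y_neq0.
- exact: expr0z.
Qed.

(** The monomial of degree 0 is the [e]-th power of the quotient of the first two
    variables of an orbit; it specializes to [zeta^(-e) = 1]. *)
Lemma form_degree (t : {scalar generic_hecke x0}) (ell : B -> int) :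
  canonical_symmetrizing_form zeta t ->
  (forall t', canonical_symmetrizing_form zeta t' -> forall h, t' h = t h) ->
  (forall a b, ell (a * b)%g = ell a + ell b) ->
  (forall O s (j : 'I_(orbit_order O)), monodromy_generator O s ->
      ell s = param_degree (Tagged _ j)) ->
  forall O : hyperplane_orbit rW,
  forall b k, ga_coef (t (hecke_gen _ b)) k != 0 -> weighted_degree param_degree k = ell b.
Proof.
move=> tP t_unique ellM ells O b k.
pose tg (j : 'I_(orbit_order O)) : parameter rW := Tagged (fun O => 'I_(orbit_order O)) j.
pose j0 : 'I_(orbit_order O) := Ordinal (ltnW (orbit_order_gt1 O)).
pose j1 : 'I_(orbit_order O) := Ordinal (orbit_order_gt1 O).
pose e : int := orbit_order O.
pose k0 := (exponent_delta (tg j0) e * exponent_delta (tg j1) (- e))%g.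
have z0 (i : parameter rW) : zeta (tag i) ^+ tagged i != 0.
  by rewrite expf_neq0 // (zeta_neq0 zetaP).
apply: (canonical_form_homogeneous (zeta_neq0 zetaP) tP t_unique (k0 := k0)) => //.
- apply: exponent_delta_difference.
  by rewrite /param_degree /= (weight_fixed_cst nuG j0 j1).
- apply: etrans (monomial_eval_difference _ _ _ z0) _.
  rewrite /= expr0 exp1rz mul1r expr1.
  by rewrite -invr_expz -exprnP (zeta_exp_order zetaP) invr1.
- apply: exponent_difference_neq1; first by rewrite /tg eq_Tagged.
  by rewrite /e -[0]/(0%:Z) eqz_nat gtn_eqF // ltnW // orbit_order_gt1.
Qed.
End Degree.

(** * Comparison of the two cyclotomic Hecke algebras *)

Section GroupCharacters.
Context (F : fieldType) (W : finGroupType) (Lambda : finType).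
Context (d : Lambda -> nat) (rho : forall l, W -> 'M[F]_(d l)).
Hypothesis rhoP : indexes_Irr (@mx_repr F W [set: W]%SET) rho.
Hypothesis char0 : forall n : nat, n.+1%:R != 0 :> F.

(** The linear extension of [rho l] to formal combinations of elements of [W], which
    is jointly closed whereas [rho] itself is not. *)
Let ext l (a : {ffun W -> F}) : 'M[F]_(d l) := \sum_w a w *: rho l w.

Let ext_delta l w : ext l [ffun x => (x == w)%:R] = rho l w.
Proof.
rewrite /ext (bigD1 w) //= ffunE eqxx scale1r big1 ?addr0 // => x /negbTE xw.
by rewrite ffunE xw scale0r.
Qed.

(** If [k] and [l] differ, equality of their characters is a nontrivial linear
    relation between traces. *)
Lemma equal_characters k l : (forall w, \tr (rho k w) = \tr (rho l w)) -> k = l.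
Proof.
move=> kl; apply/eqP/negPn/negP => nkl.
have [irr disj _] := rhoP.
have rho1 j : rho j 1%g = 1%:M by have [[]] := irr j.
have rhoM j x z : rho j (x * z)%g = rho j x *m rho j z.
  by have [[_ ->]] := irr j; rewrite ?inE.
have extL j c (a b : {ffun W -> F}) :
    ext j [ffun w => c * a w + b w] = c *: ext j a + ext j b.
  rewrite /ext scaler_sumr -big_split; apply: eq_bigr => w _ /=.
  by rewrite !ffunE scalerDl scalerA.
have closed : jointly_closed ext.
  split.
  - by exists [ffun x => (x == 1%g)%:R] => j; rewrite ext_delta.
  - by move=> c a b; exists [ffun w => c * a w + b w] => j; exact: extL.
  - move=> a b; exists [ffun z => \sum_x a x * b (x^-1 * z)%g] => j.
    rewrite /ext mulmx_suml.
    under eq_bigr do rewrite ffunE scaler_suml.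
    rewrite exchange_big; apply: eq_bigr => x _ /=.
    rewrite (reindex_inj (mulgI x)) mulmx_sumr; apply: eq_bigr => z _ /=.
    by rewrite mulKg rhoM -scalemxAl -scalemxAr scalerA.
have irrE j : irreducible (ext j).
  have [_ [d0 irrj]] := irr j; split=> // U stU; apply: irrj => w v vU.
  by rewrite -ext_delta; exact: stU.
have disjE i j : isomorphic (ext i) (ext j) -> i = j.
  move=> [P Pfull PI]; apply: disj; exists P => // w.
  by rewrite -!ext_delta.
pose c j : F := (j == k)%:R - (j == l)%:R.
have : c k = 0.
  apply: (trace_independence closed irrE disjE char0) => a.
  have ctr w : \sum_j c j * \tr (rho j w) = 0.
    rewrite (bigD1 k) //= (bigD1 l) 1?eq_sym //= big1 => [|j /andP[/negbTE jk /negbTE jl]].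
      rewrite /c !eqxx (negbTE nkl) [l == k]eq_sym (negbTE nkl) subr0 sub0r.
      by rewrite mul1r mulN1r addr0 kl subrr.
    by rewrite /c jk jl subrr mul0r.
  rewrite /ext; under eq_bigr do rewrite raddf_sum mulr_sumr.
  rewrite exchange_big big1 // => w _ /=.
  under eq_bigr do rewrite mxtraceZ mulrCA.
  by rewrite -mulr_sumr ctr mulr0.
by rewrite /c eqxx (negbTE nkl) subr0 => /eqP; rewrite oner_eq0.
Qed.
End GroupCharacters.

Section HeckeCharacters.
Context (R : realType) (K : splittingFieldType rat) (iota : {rmorphism K -> R[i]}).
Context (n : nat) (W : finGroupType) (rW : mx_representation K [set: W]%G n).
Context (x0 : Vreg iota rW) (F : fieldType) (u : parameter rW -> F).
Context (Lambda : finType) (d : Lambda -> nat) (f : forall l, hecke x0 u -> 'M[F]_(d l)).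

Lemma hecke_trace_independence (c : Lambda -> F) :
  indexes_Irr (@hecke_rep _ _ _ _ _ _ x0 _ u) f ->
  (forall n : nat, n.+1%:R != 0 :> F) ->
  (forall h, \sum_l c l * \tr (f l h) = 0) -> forall l, c l = 0.
Proof.
move=> [irr disj _] char0; apply: trace_independence => //.
- split.
  + by exists 1 => l; have [[_ -> _] _] := irr l.
  + by move=> a h h'; exists (a *: h + h') => l; have [[-> _ _] _] := irr l.
  + by move=> h h'; exists (h * h') => l; have [[_ _ ->] _] := irr l.
- by move=> l; have [_] := irr l.
Qed.

End HeckeCharacters.

Section Rescaling.
Context (R : realType) (K : splittingFieldType rat) (iota : {rmorphism K -> R[i]}).
Context (n : nat) (W : finGroupType) (rW : mx_representation K [set: W]%G n).
Context (x0 : Vreg iota rW) (F : fieldType) (u u' : parameter rW -> F).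
Local Notation B := (braid_group x0).
Context (c : B -> F).
Hypothesis c0 : forall b, c b != 0.
Hypothesis cM : forall a b, c (a * b)%g = c a * c b.
Hypothesis cu : forall O (s : B) (j : 'I_(orbit_order O)), monodromy_generator O s ->
  u' (Tagged _ j) = c s * u (Tagged _ j).

Definition rescaling : hecke x0 u' -> hecke x0 u := hecke_twist u idfun c.

Let c1 : c 1%g = 1.
Proof. by apply: (mulfI (c0 1%g)); rewrite -cM mulg1 mulr1. Qed.

Lemma rescaling_linear a h h' : rescaling (a *: h + h') = a *: rescaling h + rescaling h'.
Proof. exact: hecke_twist_semilinear. Qed.

Lemma rescalingM h h' : rescaling (h * h') = rescaling h * rescaling h'.
Proof. exact: hecke_twistM. Qed.

Lemma rescaling1 : rescaling 1 = 1.
Proof. exact: hecke_twist1. Qed.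

Lemma rescaling_gen b : rescaling (hecke_gen u' b) = c b *: hecke_gen u b.
Proof. exact: hecke_twist_gen. Qed.

Lemma rescaling0 : rescaling 0 = 0.
Proof. by have := rescaling_linear (-1) 0 0; rewrite scaler0 addr0 scaleN1r addNr. Qed.

Lemma rescaling_surj h : exists h', rescaling h' = h.
Proof.
elim/hecke_ind : h => [|a h h2 [k <-] [k2 <-]|b]; first by exists 0; exact: rescaling0.
  by exists (a *: k + k2); exact: rescaling_linear.
exists ((c b)^-1 *: hecke_gen u' b + 0).
by rewrite rescaling_linear rescaling0 addr0 rescaling_gen scalerA mulVf // scale1r.
Qed.

Lemma rescaling_form (t : {scalar hecke x0 u}) (t' : {scalar hecke x0 u'}) :
  (forall b, t' (hecke_gen u' b) = c b * t (hecke_gen u b)) ->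
  forall h, t (rescaling h) = t' h.
Proof.
move=> tt'; elim/hecke_ind => [|a h h2 IH IH2|b].
- by rewrite rescaling0 !linear0.
- by rewrite rescaling_linear !linearP IH IH2.
by rewrite rescaling_gen linearZ tt'.
Qed.

Lemma rescaling_rep e (g : hecke x0 u -> 'M[F]_e) :
  hecke_rep g -> irreducible g ->
  hecke_rep (g \o rescaling) /\ irreducible (g \o rescaling).
Proof.
move=> [gL g1 gM] [e0 irrg]; split.
  split=> [a h h'||h h'] /=; first by rewrite rescaling_linear gL.
    by rewrite rescaling1.
  by rewrite rescalingM gM.
split=> // U stU; apply: irrg => h v vU; have [h' <-] := rescaling_surj h.
exact: stU.
Qed.

Lemma rescaling_trace e (g : hecke x0 u -> 'M[F]_e) b : hecke_rep g ->
  \tr (g (rescaling (hecke_gen u' b))) = c b * \tr (g (hecke_gen u b)).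
Proof.
move=> [gL _ _]; rewrite rescaling_gen.
have g0 : g 0 = 0 by have := gL (-1) 0 0; rewrite scaler0 addr0 scaleN1r addNr.
by have := gL (c b) (hecke_gen u b) 0; rewrite g0 !addr0 => ->; rewrite mxtraceZ.
Qed.
End Rescaling.

Theorem proposition2p7
  (R : realType)
  (K : splittingFieldType rat)
  (galK : galois 1%AS {:K}%AS)
  (abK : abelian 'Gal({:K} / 1%AS))
  (iota : {rmorphism K -> R[i]})
  (n : nat) (W : finGroupType)
  (rW : mx_representation K [set: W]%G n)
  (faithW : mx_faithful rW)
  (genW : <<[set w : W | is_pseudo_reflection rW w]>>%g = [set: W]%SET)
  (irrW : irreducible (rW : W -> 'M[K]_n))
  (x0 : Vreg iota rW)
  (zeta : hyperplane_orbit rW -> K)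
  (zetaP : forall O, iota (zeta O) = zetaC R (orbit_order O))
  (freeH : free_of_rank x0 #|W|)
  (t : {scalar generic_hecke x0})
  (tP : canonical_symmetrizing_form zeta t)
  (t_unique : forall t', canonical_symmetrizing_form zeta t' -> forall h, t' h = t h)
  (Lambda : finType) (d : Lambda -> nat)
  (rho : forall l, W -> 'M[K]_(d l))
  (rhoP : indexes_Irr (@mx_repr K W [set: W]%SET) rho)
  (m nu : weight rW)
  (nuG : weight_fixed nu)
  (s s' : Lambda -> {fraction {poly K}})
  (sP : schur_elements zeta t rho m s)
  (s'P : schur_elements zeta t rho (weight_add m nu) s')
  (l : Lambda) :
  s l = s' l /\ a_function (s l) = a_function (s' l).
Proof.
suff -> : s l = s' l by [].
have [dm [rhom [tm [rhomP rhom_spec tmP s0 tmE]]]] := sP.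
have [dm' [rhom' [tm' [rhom'P rhom'_spec tm'P s'0 tm'E]]]] := s'P.
have [l0 l0P] := trivial_index rhoP.
pose y : {fraction {poly K}} := 'X%:F.
have [ell [ellM ells ell_deg]] : exists ell : braid_group x0 -> int,
    [/\ forall a b, ell (a * b)%g = ell a + ell b,
        forall O s (j : 'I_(orbit_order O)), monodromy_generator O s ->
          ell s = param_degree nu (Tagged _ j) &
        forall b k, ga_coef (t (hecke_gen _ b)) k != 0 ->
          weighted_degree (param_degree nu) k = ell b].
  have [ell [ellM ells]] : exists ell : braid_group x0 -> int,
      (forall a b, ell (a * b)%g = ell a + ell b) /\
      forall O s (j : 'I_(orbit_order O)), monodromy_generator O s ->
        ell s = param_degree nu (Tagged _ j).
    have [irr _ _] := rhomP; have [irr' _ _] := rhom'P.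
    apply: (degree_morphism zetaP nuG (irr l0).1 (irr' l0).1) => b w bw.
      by rewrite -(l0P w); exact: rhom_spec.
    by rewrite -(l0P w); exact: rhom'_spec.
  have [[ O]|noO] := pselect (inhabited (hyperplane_orbit rW)).
    by exists ell; split=> //; exact: (form_degree zetaP nuG tP t_unique ellM ells O).
  (* Without hyperplanes there are no variables, and all degrees vanish. *)
  exists (fun=> 0); split=> [//|O|b k _]; first by case: noO.
  by rewrite /weighted_degree big1 // => -[ O j] _; case: noO.
pose c b := y ^ ell b.
have y0 : y != 0 by exact: y_neq0.
have c0 b : c b != 0 by exact: expyz_neq0.
have cM a b : c (a * b)%g = c a * c b by rewrite /c ellM expfzDr.
pose u := cyclotomic_param zeta m; pose u' := cyclotomic_param zeta (weight_add m nu).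
have cu O b (j : 'I_(orbit_order O)) : monodromy_generator O b ->
    u' (Tagged _ j) = c b * u (Tagged _ j).
  by move=> bO; rewrite /u' param_degree_shift /c (ells O b j bO).
pose theta : hecke x0 u' -> hecke x0 u := rescaling u c.
have tm_theta : forall h, tm (theta h) = tm' h.
  apply: (rescaling_form c0 cM cu) => b.
  by rewrite tmP tm'P (laurent_eval_shift zeta m (ell_deg b)).
(* The labels are compared through the characters of [W] at [y = 1]. *)
have matched k : isomorphic (rhom k \o theta) (rhom' k).
  have [irr _ _] := rhomP; have [_ _ exh'] := rhom'P.
  have [rep_th irr_th] := rescaling_rep c0 cM cu (irr k).1 (irr k).2.
  have [k' iso] := exh' _ _ rep_th irr_th.
  suff kk' : k' = k by move: iso; rewrite kk'.
  apply/esym/(equal_characters rhoP) => [i|w].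
    by rewrite -(rmorph_nat (in_alg K)) fmorph_eq0 pnatr_eq0.
  have [b bw] := lifts_exist x0 w.
  have := isomorphic_trace iso (hecke_gen u' b).
  rewrite [LHS](rescaling_trace c0 cM cu b (irr k).1) => trE.
  apply: specializes_unique (rhom'_spec k' b w bw).
  rewrite -trE -[\tr (rho k w)]mul1r; apply: specializesM; first exact: specializes_expyz.
  exact: rhom_spec.
have : (s l)^-1 - (s' l)^-1 = 0.
  pose cc k := (s k)^-1 - (s' k)^-1.
  apply: (hecke_trace_independence (c := cc) rhom'P (@fraction_char0 K)) => h.
  under eq_bigr do rewrite mulrBl.
  rewrite big_split /= sumrN -tm'E -tm_theta tmE; apply/eqP; rewrite subr_eq0; apply/eqP.
  by apply: eq_bigr => k _; rewrite -(isomorphic_trace (matched k)).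
by move/eqP; rewrite subr_eq0 => /eqP/invr_inj.
Qed.
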